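(* The reparameterization action of $\mathrm{Diff}^+(S^1)$ on $\mathcal{M}$ is Hamiltonian with momentum map $$\mu_{\mathrm{Diff}}:\mathcal{M}\to\mathcal{L}\mathbb{R},\qquad [\Phi]\mapsto\mathrm{Im}\big(\phi'\overline{\phi}+\psi'\overline{\psi}\big),\quad \Phi=(\phi,\psi).$$ That is, for every $\xi\in\mathcal{L}\mathbb{R}$, setting $f_\xi([\Phi])=\langle\mu_{\mathrm{Diff}}([\Phi]),\xi\rangle_{\mathcal{L}\mathbb{R}}$, one has for every $[\Phi]$ and every tangent vector $\delta\Phi$ at $[\Phi]$ $$Df_\xi([\Phi])(\delta\Phi)=\omega^{L^2}_{[\Phi]}\big(\delta\Phi,X_\xi|_{[\Phi]}\big),$$ where $X_\xi$ is the vector field on $\mathcal{M}$ induced by $\xi$.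
   Context: Let $S^1=[0,2]/(0\sim2)$, $\mathcal{L}M=C^\infty(S^1,M)$, and let $\mathcal{A}\mathbb{C}$ be the space of smooth $\phi:[0,2]\to\mathbb{C}$ with $\phi^{(k)}(2)=-\phi^{(k)}(0)$ for all $k\ge0$. $\mathcal{M}$ is the moduli space of framed loops: pairs $(\gamma,V)$ of smooth maps $S^1\to\mathbb{R}^3$ with $\gamma$ an immersion and $V$ a unit field normal to $\gamma'$, modulo translations, rotations, scalings of $\gamma$, and constant rotations of $V$ about $\gamma'$. For $\mathcal{V}=\mathcal{L}\mathbb{C}$ or $\mathcal{A}\mathbb{C}$, let $\mathrm{St}_2(\mathcal{V})$ be the set of pairs $\Phi=(\phi,\psi)\in\mathcal{V}^2$ orthonormal for $\langle\phi,\psi\rangle_{L^2}=\int_0^2\phi\bar\psi\,dt$, and $\mathrm{Gr}_2(\mathcal{V})=\mathrm{St}_2(\mathcal{V})/\mathrm{U}(2)$ (right multiplication); $\mathrm{Gr}_2^\circ(\mathcal{V})$ is the open subset of classes with $\Phi(t)\neq\vec0$ for all $t$. Identifying $(z,w)\in\mathbb{C}^2$ with the quaternion $q=z+w\mathbf{j}$ and imaginary quaternions with $\mathbb{R}^3$, the assignment $q(t)\mapsto(\gamma,V)$, $\gamma'=\bar q\mathbf{i}q$, $V=\bar q\mathbf{j}q/|q|^2$, induces a diffeomorphism $\mathrm{Gr}_2^\circ(\mathcal{L}\mathbb{C})\sqcup\mathrm{Gr}_2^\circ(\mathcal{A}\mathbb{C})\approx\mathcal{M}$, through which elements of $\mathcal{M}$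 are written $[\Phi]$. The tangent space at $[\Phi]$ is represented by the horizontal space $T^{hor}_\Phi\mathrm{St}_2(\mathcal{V})=\{(\delta\phi,\delta\psi)\in\mathcal{V}^2:\langle\phi,\delta\phi\rangle_{L^2}=\langle\psi,\delta\psi\rangle_{L^2}=\langle\phi,\delta\psi\rangle_{L^2}=\langle\psi,\delta\phi\rangle_{L^2}=0\}$, on which the symplectic form is $\omega^{L^2}=-\mathrm{Im}\langle\cdot,\cdot\rangle_{L^2}$. $\rho\in\mathrm{Diff}^+(S^1)$ (orientation-preserving diffeomorphisms) acts by $(\gamma,V)\mapsto(\gamma\circ\rho,V\circ\rho)$, equivalently $\rho\cdot[\Phi]=[\sqrt{\rho'}\,\Phi\circ\rho]$. The Lie algebra of $\mathrm{Diff}^+(S^1)$ is $\mathcal{L}\mathbb{R}$, embedded in its dual by $\langle\xi_1,\xi_2\rangle_{\mathcal{L}\mathbb{R}}=\frac12\int_{S^1}\xi_1\xi_2\,dt$. The induced vector field of $\xi\in\mathcal{L}\mathbb{R}$ is represented by $X_\xi|_{[\Phi]}=\mathrm{proj}(\frac12\xi'\Phi+\xi\Phi')$, where $\mathrm{proj}:T_\Phi\mathrm{St}_2(\mathcal{V})\to T_\Phi^{hor}\mathrm{St}_2(\mathcal{V})$ is $L^2$-orthogonal projection. *)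

(* Defs.v *)
(* Stdlib reals with Coquelicot. *)
From Stdlib Require Import Reals Lra Lia Psatz Relations FunctionalExtensionality.
From Coquelicot Require Import Coquelicot.
Open Scope R_scope.

Definition smooth (f : R -> R) : Prop := forall n t, ex_derive_n f n t.

Definition smoothC (f : R -> C) : Prop :=
  smooth (fun t => Re (f t)) /\ smooth (fun t => Im (f t)).

(* Joint smoothness in two real variables; a jointly smooth function of (s, t)
   is a smooth curve s |-> f s in the Frechet space of smooth functions of t. *)
Definition smooth2 (f : R -> R -> R) : Prop := forall n s t, ex_diff_n f n s t.

Definition CDerive (f : R -> C) (t : R) : C :=
  (Derive (fun u => Re (f u)) t, Derive (fun u => Im (f u)) t).

(** * Closure properties of smooth functions *)

Fixpoint Ck (n : nat) (f : R -> R) : Prop :=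
  match n with
  | O => True
  | S m => (forall t, ex_derive f t) /\ Ck m (Derive f)
  end.

Lemma Ck_ex_derive_n n f k t : Ck n f -> (k <= n)%nat -> ex_derive_n f k t.
Proof.
revert f k t; induction n as [|n IH]; intros f k t H Hk.
- now replace k with O by lia.
- destruct k as [|[|k]]; [exact I|now apply H|].
  assert (H1 := IH _ (S k) t (proj2 H) ltac:(lia)); simpl in H1 |- *.
  apply (ex_derive_ext (Derive_n (Derive f) k)); [|exact H1].
  intros u; change (Derive f) with (Derive_n f 1).
  rewrite Derive_n_comp; now replace (k + 1)%nat with (S k) by lia.
Qed.

Lemma ex_derive_n_Ck n f : (forall k t, (k <= n)%nat -> ex_derive_n f k t) -> Ck n f.
Proof.
revert f; induction n as [|n IH]; intros f H; [exact I|].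
split; [intros t; now apply (H 1%nat); lia|].
apply IH; intros [|k] t Hk; [exact I|].
assert (H1 := H (S (S k)) t ltac:(lia)); simpl in H1 |- *.
apply (ex_derive_ext (Derive_n f (S k))); [|exact H1].
intros u; change (Derive f) with (Derive_n f 1).
rewrite Derive_n_comp; now replace (k + 1)%nat with (S k) by lia.
Qed.

Lemma smoothP f : smooth f <-> forall n, Ck n f.
Proof.
split; intros H n.
- apply ex_derive_n_Ck; intros k t _; apply H.
- intros t; now apply (Ck_ex_derive_n n).
Qed.

Lemma Ck_ext n f g : (forall t, f t = g t) -> Ck n f -> Ck n g.
Proof. now intros H; replace g with f by now apply functional_extensionality. Qed.

Lemma smooth_ext f g : (forall t, f t = g t) -> smooth f -> smooth g.
Proof. now intros H; replace g with f by now apply functional_extensionality. Qed.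

Lemma Ck_le n f : Ck (S n) f -> Ck n f.
Proof.
revert f; induction n as [|n IH]; intros f H; [exact I|].
split; [apply H|apply IH, H].
Qed.

Lemma Ck_const n c : Ck n (fun _ => c).
Proof.
revert c; induction n as [|n IH]; intros c; [exact I|].
split; [intros t; apply ex_derive_const|].
apply (Ck_ext _ (fun _ => 0)); [intros t; now rewrite Derive_const|apply IH].
Qed.

Lemma Ck_plus n f g : Ck n f -> Ck n g -> Ck n (fun t => f t + g t).
Proof.
revert f g; induction n as [|n IH]; intros f g Hf Hg; [exact I|].
split.
- intros t; apply (ex_derive_plus f g); [apply Hf|apply Hg].
- apply (Ck_ext _ (fun t => Derive f t + Derive g t)).
  + intros t; symmetry; apply Derive_plus; [apply Hf|apply Hg].
  + apply IH; [apply Hf|apply Hg].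
Qed.

Lemma Ck_mult n f g : Ck n f -> Ck n g -> Ck n (fun t => f t * g t).
Proof.
revert f g; induction n as [|n IH]; intros f g Hf Hg; [exact I|].
split.
- intros t; apply ex_derive_mult; [apply Hf|apply Hg].
- apply (Ck_ext _ (fun t => Derive f t * g t + f t * Derive g t)).
  + intros t; symmetry; apply Derive_mult; [apply Hf|apply Hg].
  + apply Ck_plus; apply IH; try (now apply Ck_le); [apply Hf|apply Hg].
Qed.

Lemma Ck_comp n f g : Ck n f -> Ck n g -> Ck n (fun t => f (g t)).
Proof.
revert f g; induction n as [|n IH]; intros f g Hf Hg; [exact I|].
split.
- intros t; apply (ex_derive_comp f g); [apply Hf|apply Hg].
- apply (Ck_ext _ (fun t => Derive g t * Derive f (g t))).
  + intros t; symmetry; apply Derive_comp; [apply Hf|apply Hg].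
  + apply Ck_mult; [apply Hg|].
    apply IH; [apply Hf|now apply Ck_le].
Qed.

Lemma Ck_inv n f : (forall t, f t <> 0) -> Ck n f -> Ck n (fun t => / f t).
Proof.
intros H0; induction n as [|n IH]; intros Hf; [exact I|].
split.
- intros t; apply ex_derive_inv; [apply Hf|apply H0].
- apply (Ck_ext _ (fun t => (-1 * Derive f t) * (/ f t * / f t))).
  + intros t; rewrite Derive_inv; [field; apply H0|apply Hf|apply H0].
  + assert (IH' := IH (Ck_le _ _ Hf)).
    now apply Ck_mult; apply Ck_mult; try apply Ck_const; try apply Hf.
Qed.

Lemma Ck_sqrt n f : (forall t, 0 < f t) -> Ck n f -> Ck n (fun t => sqrt (f t)).
Proof.
intros H0; induction n as [|n IH]; intros Hf; [exact I|].
assert (Hd : forall t,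
  is_derive (fun t => sqrt (f t)) t (Derive f t * / (2 * sqrt (f t)))).
{ intros t; apply is_derive_sqrt; [|apply H0].
  apply Derive_correct, Hf. }
split.
- intros t; eexists; apply Hd.
- apply (Ck_ext _ (fun t => Derive f t * / (2 * sqrt (f t)))).
  + intros t; symmetry; apply is_derive_unique, Hd.
  + apply Ck_mult; [apply Hf|].
    apply (Ck_inv n (fun t => 2 * sqrt (f t))).
    * intros t; assert (H := sqrt_lt_R0 _ (H0 t)); lra.
    * apply Ck_mult; [apply Ck_const|now apply IH, Ck_le].
Qed.

Lemma smooth_const c : smooth (fun _ => c).
Proof. apply smoothP; intros n; apply Ck_const. Qed.

Lemma smooth_id : smooth (fun t => t).
Proof.
apply smoothP; intros [|n]; [exact I|split; [intros t; apply ex_derive_id|]].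
apply (Ck_ext _ (fun _ => 1)); [intros t; symmetry; apply Derive_id|].
apply Ck_const.
Qed.

Lemma smooth_plus f g : smooth f -> smooth g -> smooth (fun t => f t + g t).
Proof. rewrite !smoothP; intros Hf Hg n; now apply Ck_plus. Qed.

Lemma smooth_mult f g : smooth f -> smooth g -> smooth (fun t => f t * g t).
Proof. rewrite !smoothP; intros Hf Hg n; now apply Ck_mult. Qed.

Lemma smooth_comp f g : smooth f -> smooth g -> smooth (fun t => f (g t)).
Proof. rewrite !smoothP; intros Hf Hg n; now apply Ck_comp. Qed.

Lemma smooth_opp f : smooth f -> smooth (fun t => - f t).
Proof.
intros Hf; apply (smooth_ext (fun t => -1 * f t)); [intros t; ring|].
apply smooth_mult; [apply smooth_const|exact Hf].
Qed.

Lemma smooth_minus f g : smooth f -> smooth g -> smooth (fun t => f t - g t).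
Proof. intros Hf Hg; apply smooth_plus; [|apply smooth_opp]; assumption. Qed.

Lemma smooth_inv f : (forall t, f t <> 0) -> smooth f -> smooth (fun t => / f t).
Proof. rewrite !smoothP; intros H0 Hf n; now apply Ck_inv. Qed.

Lemma smooth_sqrt f : (forall t, 0 < f t) -> smooth f -> smooth (fun t => sqrt (f t)).
Proof. rewrite !smoothP; intros H0 Hf n; now apply Ck_sqrt. Qed.

Lemma smooth_Derive f : smooth f -> smooth (Derive f).
Proof. rewrite !smoothP; intros Hf n; apply (Hf (S n)). Qed.

Lemma smooth_ex_derive f t : smooth f -> ex_derive f t.
Proof. intros Hf; apply (Hf 1%nat). Qed.

Lemma smooth_continuous f t : smooth f -> continuous f t.
Proof. intros Hf; now apply (ex_derive_continuous f), smooth_ex_derive. Qed.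

Lemma smooth_ex_RInt f a b : smooth f -> ex_RInt f a b.
Proof. intros Hf; apply (ex_RInt_continuous f); intros; now apply smooth_continuous. Qed.

Lemma is_derive_primitive f a t :
  smooth f -> is_derive (fun t => RInt f a t) t (f t).
Proof.
intros Hf; apply (is_derive_RInt f _ a).
- apply filter_forall; intros u; apply (RInt_correct f); now apply smooth_ex_RInt.
- now apply smooth_continuous.
Qed.

Lemma smooth_primitive f a : smooth f -> smooth (fun t => RInt f a t).
Proof.
intros Hf; apply smoothP; intros [|n]; [exact I|split].
- intros t; eexists; now apply is_derive_primitive.
- apply (Ck_ext _ f).
  + intros t; symmetry; apply is_derive_unique; now apply is_derive_primitive.
  + now apply smoothP.
Qed.

Lemma RInt_period f a :
  smooth f -> (forall t, f (t + 2) = f t) -> RInt f a (a + 2) = RInt f 0 2.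
Proof.
intros Hf Hp.
assert (H2 : forall c, RInt f 2 (c + 2) = RInt f 0 c).
{ intros c; assert (H := RInt_comp_lin f 1 2 0 c).
  replace (1 * 0 + 2) with 2 in H by ring; replace (1 * c + 2) with (c + 2) in H by ring.
  rewrite <- H by now apply smooth_ex_RInt.
  apply RInt_ext; intros x _; unfold scal; simpl; unfold mult; simpl.
  rewrite !Rmult_1_l; apply Hp. }
assert (C1 := RInt_Chasles f a 0 (a + 2) (smooth_ex_RInt f _ _ Hf) (smooth_ex_RInt f _ _ Hf)).
assert (C2 := RInt_Chasles f 0 2 (a + 2) (smooth_ex_RInt f _ _ Hf) (smooth_ex_RInt f _ _ Hf)).
assert (C3 := opp_RInt_swap f a 0 (smooth_ex_RInt f _ _ Hf)).
unfold plus, opp in *; simpl in *.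
rewrite <- C1, <- C2, H2; lra.
Qed.

Ltac smooth_tac :=
  first
    [ eassumption
    | lazymatch goal with
      | |- smooth (fun _ => ?c) => apply smooth_const
      | |- smooth (fun t => _ + _) => apply smooth_plus; smooth_tac
      | |- smooth (fun t => _ - _) => apply smooth_minus; smooth_tac
      | |- smooth (fun t => _ * _) => apply smooth_mult; smooth_tac
      | |- smooth (fun t => - _) => apply smooth_opp; smooth_tac
      end
    | idtac ].

(** * Loops and antiloops *)

(* Functions on S^1 = [0,2]/(0 ~ 2) are 2-periodic functions on the line. *)
Record LoopR := mkLoopR {
  loop_fun :> R -> R;
  loop_smooth : smooth loop_fun;
  loop_period : forall t, loop_fun (t + 2) = loop_fun t
}.

Definition pairing (x y : LoopR) : R := / 2 * RInt (fun t => x t * y t) 0 2.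

(* [per] selects L C and [anti] selects A C. *)
Inductive kind := per | anti.

Definition sign (k : kind) : R := match k with per => 1 | anti => -1 end.

(* A smooth function on [0,2] whose derivatives of every order at 2 equal
   [sign k] times those at 0 is identified with its unique smooth extension to
   the line satisfying f (t + 2) = sign k * f t; see [inV_endpoints] and
   [inV_extension]. *)
Definition inV (k : kind) (f : R -> C) : Prop :=
  smoothC f /\ forall t, f (t + 2) = (RtoC (sign k) * f t)%C.

Notation path := (R -> C * C).

Definition inV2 (k : kind) (P : path) : Prop :=
  inV k (fun t => fst (P t)) /\ inV k (fun t => snd (P t)).

Definition L2 (f g : R -> C) : C :=
  RInt (V := C_R_CompleteNormedModule) (fun t => (f t * Cconj (g t))%C) 0 2.

Definition L2pair (P Q : path) : C :=
  (L2 (fun t => fst (P t)) (fun t => fst (Q t))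
   + L2 (fun t => snd (P t)) (fun t => snd (Q t)))%C.

(* Stiefel pairs with no zero: the representatives of Gr_2°. *)
Record St (k : kind) := mkSt {
  st_path :> path;
  st_inV2 : inV2 k st_path;
  st_norm1 : L2 (fun t => fst (st_path t)) (fun t => fst (st_path t)) = RtoC 1;
  st_norm2 : L2 (fun t => snd (st_path t)) (fun t => snd (st_path t)) = RtoC 1;
  st_orth : L2 (fun t => fst (st_path t)) (fun t => snd (st_path t)) = RtoC 0;
  st_nonzero : forall t, st_path t <> (RtoC 0, RtoC 0)
}.

(** * Quaternions and vectors of R^3 *)

(* (z, w) stands for z + w j. *)
Definition quat : Type := C * C.
Definition qmul (p q : quat) : quat :=
  ((fst p * fst q - snd p * Cconj (snd q))%C,
   (fst p * snd q + snd p * Cconj (fst q))%C).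
Definition qconj (q : quat) : quat := (Cconj (fst q), (- snd q)%C).
Definition qi : quat := (Ci, RtoC 0).
Definition qj : quat := (RtoC 0, RtoC 1).
Definition qnorm2 (q : quat) : R := (Cmod (fst q))^2 + (Cmod (snd q))^2.

Definition vec : Type := R * R * R.
Definition vx (v : vec) : R := fst (fst v).
Definition vy (v : vec) : R := snd (fst v).
Definition vz (v : vec) : R := snd v.
Definition vadd (u v : vec) : vec := (vx u + vx v, vy u + vy v, vz u + vz v).
Definition vscal (a : R) (v : vec) : vec := (a * vx v, a * vy v, a * vz v).
Definition vdot (u v : vec) : R := vx u * vx v + vy u * vy v + vz u * vz v.
Definition vcross (u v : vec) : vec :=
  (vy u * vz v - vz u * vy v, vz u * vx v - vx u * vz v, vx u * vy v - vy u * vx v).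
Definition vnorm (v : vec) : R := sqrt (vdot v v).

(* The i, j, k components. *)
Definition vec_of_quat (q : quat) : vec := (Im (fst q), Re (snd q), Im (snd q)).

Definition smoothv (g : R -> vec) : Prop :=
  smooth (fun t => vx (g t)) /\ smooth (fun t => vy (g t)) /\ smooth (fun t => vz (g t)).

Definition vDerive (g : R -> vec) (t : R) : vec :=
  (Derive (fun u => vx (g u)) t, Derive (fun u => vy (g u)) t,
   Derive (fun u => vz (g u)) t).

Definition vRInt (g : R -> vec) (a b : R) : vec :=
  (RInt (fun u => vx (g u)) a b, RInt (fun u => vy (g u)) a b,
   RInt (fun u => vz (g u)) a b).

Definition rotation (A : vec -> vec) : Prop :=
  exists e1 e2, vdot e1 e1 = 1 /\ vdot e2 e2 = 1 /\ vdot e1 e2 = 0 /\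
  forall v, A v = vadd (vscal (vx v) e1)
                       (vadd (vscal (vy v) e2) (vscal (vz v) (vcross e1 e2))).

(** * The moduli space of framed loops *)

Record FramedLoop := mkFramedLoop {
  curve : R -> vec;
  frame : R -> vec;
  curve_smooth : smoothv curve;
  frame_smooth : smoothv frame;
  curve_period : forall t, curve (t + 2) = curve t;
  frame_period : forall t, frame (t + 2) = frame t;
  curve_immersion : forall t, vDerive curve t <> (0, 0, 0);
  frame_unit : forall t, vdot (frame t) (frame t) = 1;
  frame_normal : forall t, vdot (frame t) (vDerive curve t) = 0
}.

Definition tangent (F : FramedLoop) (t : R) : vec :=
  vscal (/ vnorm (vDerive (curve F) t)) (vDerive (curve F) t).

Inductive framed_move (F G : FramedLoop) : Prop :=
| move_translate (c : vec) :
    (forall t, curve G t = vadd (curve F t) c) ->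
    (forall t, frame G t = frame F t) -> framed_move F G
| move_rotate (A : vec -> vec) : rotation A ->
    (forall t, curve G t = A (curve F t)) ->
    (forall t, frame G t = A (frame F t)) -> framed_move F G
| move_scale (a : R) : 0 < a ->
    (forall t, curve G t = vscal a (curve F t)) ->
    (forall t, frame G t = frame F t) -> framed_move F G
| move_spin (th : R) :
    (forall t, curve G t = curve F t) ->
    (forall t, frame G t =
       vadd (vscal (cos th) (frame F t))
            (vscal (sin th) (vcross (tangent F t) (frame F t)))) ->
    framed_move F G.

Definition framed_equiv : relation FramedLoop := clos_refl_sym_trans _ framed_move.

Definition Moduli : Type :=
  { A : FramedLoop -> Prop | exists F, A = framed_equiv F }.

Definition framed_class (F : FramedLoop) : Moduli :=
  exist _ (framed_equiv F) (ex_intro _ F eq_refl).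

(** * The framed loop of a Stiefel pair *)

Definition hopf_velocity (q : quat) : vec := vec_of_quat (qmul (qconj q) (qmul qi q)).

Definition hopf_frame (q : quat) : vec :=
  vscal (/ qnorm2 q) (vec_of_quat (qmul (qconj q) (qmul qj q))).

Lemma qnorm2E q :
  qnorm2 q = (Re (fst q))^2 + (Im (fst q))^2 + ((Re (snd q))^2 + (Im (snd q))^2).
Proof. unfold qnorm2, Cmod, Re, Im; rewrite !pow2_sqrt; nra. Qed.

Lemma hopf_velocityE q :
  hopf_velocity q =
  ((Re (fst q))^2 + (Im (fst q))^2 - (Re (snd q))^2 - (Im (snd q))^2,
   2 * (Im (fst q) * Re (snd q) - Re (fst q) * Im (snd q)),
   2 * (Re (fst q) * Re (snd q) + Im (fst q) * Im (snd q))).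
Proof.
destruct q as [[a b] [c d]].
unfold hopf_velocity, vec_of_quat, qmul, qconj, qi, Re, Im; simpl.
repeat (f_equal; try ring).
Qed.

Lemma hopf_frameE q :
  hopf_frame q =
  vscal (/ qnorm2 q)
  (2 * (Re (fst q) * Im (snd q) + Im (fst q) * Re (snd q)),
   (Re (fst q))^2 - (Im (fst q))^2 + (Re (snd q))^2 - (Im (snd q))^2,
   2 * (Re (snd q) * Im (snd q) - Re (fst q) * Im (fst q))).
Proof.
unfold hopf_frame; f_equal.
destruct q as [[a b] [c d]].
unfold vec_of_quat, qmul, qconj, qj, Re, Im; simpl.
repeat (f_equal; try ring).
Qed.

Lemma qnorm2_gt0 q : q <> (RtoC 0, RtoC 0) -> 0 < qnorm2 q.
Proof.
rewrite qnorm2E; destruct q as [[a b] [c d]]; unfold Re, Im; simpl; intros H.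
destruct (Req_dec a 0) as [->|]; [|nra].
destruct (Req_dec b 0) as [->|]; [|nra].
destruct (Req_dec c 0) as [->|]; [|nra].
destruct (Req_dec d 0) as [->|]; [|nra].
now elim H.
Qed.

Lemma RInt_C (f : R -> C) a b : smoothC f ->
  RInt (V := C_R_CompleteNormedModule) f a b =
  (RInt (fun t => Re (f t)) a b, RInt (fun t => Im (f t)) a b).
Proof.
intros [H1 H2]; apply (is_RInt_unique (V := C_R_CompleteNormedModule)).
apply (is_RInt_fct_extend_pair (U := R_NormedModule) (V := R_NormedModule)).
- apply (RInt_correct (fun t => Re (f t))); now apply smooth_ex_RInt.
- apply (RInt_correct (fun t => Im (f t))); now apply smooth_ex_RInt.
Qed.

Lemma smoothC_mult_conj f g :
  smoothC f -> smoothC g -> smoothC (fun t => (f t * Cconj (g t))%C).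
Proof.
intros [f1 f2] [g1 g2]; unfold smoothC, Re, Im in *; simpl; split; smooth_tac.
Qed.

Lemma L2E f g : smoothC f -> smoothC g ->
  L2 f g =
  (RInt (fun t => Re (f t) * Re (g t) + Im (f t) * Im (g t)) 0 2,
   RInt (fun t => Im (f t) * Re (g t) - Re (f t) * Im (g t)) 0 2).
Proof.
intros Hf Hg; unfold L2; rewrite RInt_C by now apply smoothC_mult_conj.
f_equal; apply RInt_ext; intros t _; unfold Re, Im; simpl; ring.
Qed.

Section FramedLoopOfStiefel.

Variables (k : kind) (P : St k).

Let a t := Re (fst (P t)).
Let b t := Im (fst (P t)).
Let c t := Re (snd (P t)).
Let d t := Im (snd (P t)).

Let Ha : smooth a. Proof. apply (st_inV2 k P). Qed.
Let Hb : smooth b. Proof. apply (st_inV2 k P). Qed.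
Let Hc : smooth c. Proof. apply (st_inV2 k P). Qed.
Let Hd : smooth d. Proof. apply (st_inV2 k P). Qed.

Let Hz : smoothC (fun t => fst (P t)). Proof. now split. Qed.
Let Hw : smoothC (fun t => snd (P t)). Proof. now split. Qed.

Lemma st_period t : P (t + 2) = (RtoC (sign k) * fst (P t), RtoC (sign k) * snd (P t))%C.
Proof.
destruct (st_inV2 k P) as [[_ H1] [_ H2]].
now rewrite <- H1, <- H2, <- surjective_pairing.
Qed.

Lemma st_hopf_velocity_period t : hopf_velocity (P (t + 2)) = hopf_velocity (P t).
Proof.
rewrite st_period, !hopf_velocityE; unfold Re, Im; simpl.
destruct k; simpl; repeat (f_equal; try ring).
Qed.

Lemma st_hopf_frame_period t : hopf_frame (P (t + 2)) = hopf_frame (P t).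
Proof.
rewrite st_period, !hopf_frameE, !qnorm2E; unfold Re, Im; simpl.
f_equal; [f_equal|]; destruct k; simpl; repeat (f_equal; try ring).
Qed.

Lemma st_hopf_velocity_smooth : smoothv (fun t => hopf_velocity (P t)).
Proof.
unfold smoothv; repeat split; eapply smooth_ext;
  try (intros t; rewrite hopf_velocityE; unfold vx, vy, vz; simpl; reflexivity);
  fold (a) (b) (c) (d); smooth_tac; try apply Ha; try apply Hb; try apply Hc; try apply Hd.
Qed.

Lemma st_qnorm2_smooth : smooth (fun t => qnorm2 (P t)).
Proof.
eapply smooth_ext; [intros t; rewrite (qnorm2E (P t)); simpl; reflexivity|].
smooth_tac; try apply Ha; try apply Hb; try apply Hc; try apply Hd.
Qed.

Lemma st_hopf_frame_smooth : smoothv (fun t => hopf_frame (P t)).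
Proof.
assert (Hn : smooth (fun t => / qnorm2 (P t))).
{ apply smooth_inv; [|apply st_qnorm2_smooth].
  intros t; apply Rgt_not_eq, qnorm2_gt0, st_nonzero. }
unfold smoothv; repeat split; eapply smooth_ext;
  try (intros t; rewrite hopf_frameE; unfold vscal, vx, vy, vz; simpl; reflexivity);
  (apply smooth_mult; [exact Hn|]);
  smooth_tac; try apply Ha; try apply Hb; try apply Hc; try apply Hd.
Qed.

Definition hopf_curve (t : R) : vec := vRInt (fun u => hopf_velocity (P u)) 0 t.

Lemma hopf_curve_smooth : smoothv hopf_curve.
Proof.
destruct st_hopf_velocity_smooth as [Hx [Hy Hz']].
repeat split; unfold hopf_curve, vRInt, vx, vy, vz; simpl;
  now apply smooth_primitive.
Qed.

Lemma hopf_curve_derive t : vDerive hopf_curve t = hopf_velocity (P t).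
Proof.
destruct st_hopf_velocity_smooth as [Hx [Hy Hz']].
set (h := fun t => hopf_velocity (P t)).
transitivity (vx (h t), vy (h t), vz (h t)).
- unfold vDerive; f_equal; [f_equal|]; apply is_derive_unique.
  + exact (is_derive_primitive _ 0 t Hx).
  + exact (is_derive_primitive _ 0 t Hy).
  + exact (is_derive_primitive _ 0 t Hz').
- unfold h; now destruct (hopf_velocity (P t)) as [[? ?] ?].
Qed.

Lemma hopf_closed : hopf_curve 2 = (0, 0, 0).
Proof.
assert (N1 := f_equal Re (st_norm1 k P)); assert (N2 := f_equal Re (st_norm2 k P)).
assert (O1 := f_equal Re (st_orth k P)); assert (O2 := f_equal Im (st_orth k P)).
rewrite L2E in N1, N2, O1, O2 by assumption.
fold a b c d in N1, N2, O1, O2; unfold Re, Im in N1, N2, O1, O2; simpl in N1, N2, O1, O2.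
unfold hopf_curve, vRInt.
assert (S2 : forall f g, smooth f -> smooth g -> ex_RInt (fun t => f t * g t) 0 2)
  by (intros; apply smooth_ex_RInt; smooth_tac).
f_equal; [f_equal|].
- transitivity (RInt (fun t => minus (a t * a t + b t * b t) (c t * c t + d t * d t)) 0 2).
  + apply RInt_ext; intros t _; rewrite hopf_velocityE.
    unfold vx, minus, plus, opp, a, b, c, d; simpl; ring.
  + rewrite (RInt_minus (V := R_CompleteNormedModule)).
    * change (RInt (fun t => a t * a t + b t * b t) 0 2
              + - RInt (fun t => c t * c t + d t * d t) 0 2 = 0).
      unfold a, b, c, d, Re, Im in *; lra.
    * apply smooth_ex_RInt; smooth_tac.
    * apply smooth_ex_RInt; smooth_tac.
- transitivity (RInt (fun t => scal 2 (b t * c t - a t * d t)) 0 2).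
  + apply RInt_ext; intros t _; rewrite hopf_velocityE.
    unfold vy, scal, a, b, c, d; simpl; unfold mult; simpl; ring.
  + rewrite (RInt_scal (V := R_CompleteNormedModule)).
    * unfold a, b, c, d, Re, Im in *; rewrite O2; unfold scal; simpl; unfold mult; simpl; ring.
    * apply smooth_ex_RInt; smooth_tac.
- transitivity (RInt (fun t => scal 2 (a t * c t + b t * d t)) 0 2).
  + apply RInt_ext; intros t _; rewrite hopf_velocityE.
    unfold vz, scal, a, b, c, d; simpl; unfold mult; simpl; ring.
  + rewrite (RInt_scal (V := R_CompleteNormedModule)).
    * unfold a, b, c, d, Re, Im in *; rewrite O1; unfold scal; simpl; unfold mult; simpl; ring.
    * apply smooth_ex_RInt; smooth_tac.
Qed.

Lemma hopf_curve_period t : hopf_curve (t + 2) = hopf_curve t.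
Proof.
destruct st_hopf_velocity_smooth as [Hx [Hy Hz']].
assert (H0 := hopf_closed).
assert (Hp : forall f, smooth f -> (forall t, f (t + 2) = f t) -> RInt f 0 2 = 0 ->
  RInt f 0 (t + 2) = RInt f 0 t).
{ intros f Hf Hper Hf0.
  assert (H := RInt_Chasles f 0 t (t + 2) (smooth_ex_RInt f _ _ Hf) (smooth_ex_RInt f _ _ Hf)).
  rewrite RInt_period, Hf0 in H by assumption.
  change (RInt f 0 t + 0 = RInt f 0 (t + 2)) in H; lra. }
unfold hopf_curve, vRInt in *; injection H0; intros E3 E2 E1.
f_equal; [f_equal|]; apply Hp; try assumption;
  intros u; now rewrite st_hopf_velocity_period.
Qed.

Lemma hopf_velocity_norm2 q : vdot (hopf_velocity q) (hopf_velocity q) = (qnorm2 q)^2.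
Proof. rewrite hopf_velocityE, qnorm2E; unfold vdot, vx, vy, vz; simpl; ring. Qed.

Lemma hopf_curve_immersion t : vDerive hopf_curve t <> (0, 0, 0).
Proof.
rewrite hopf_curve_derive; intros H.
assert (N := hopf_velocity_norm2 (P t)); rewrite H in N.
unfold vdot, vx, vy, vz in N; simpl in N.
assert (N0 := qnorm2_gt0 _ (st_nonzero k P t)); nra.
Qed.

Lemma hopf_frame_unit t : vdot (hopf_frame (P t)) (hopf_frame (P t)) = 1.
Proof.
assert (N0 := qnorm2_gt0 _ (st_nonzero k P t)).
rewrite hopf_frameE; rewrite qnorm2E in *.
unfold vdot, vscal, vx, vy, vz; simpl; field.
intros E; apply (Rgt_not_eq _ _ N0); rewrite <- E; ring.
Qed.

Lemma hopf_frame_normal t : vdot (hopf_frame (P t)) (vDerive hopf_curve t) = 0.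
Proof.
rewrite hopf_curve_derive, hopf_frameE, hopf_velocityE.
unfold vdot, vscal, vx, vy, vz; simpl; ring.
Qed.

Definition framed_loop_of : FramedLoop :=
  mkFramedLoop hopf_curve (fun t => hopf_frame (P t))
    hopf_curve_smooth st_hopf_frame_smooth hopf_curve_period st_hopf_frame_period
    hopf_curve_immersion hopf_frame_unit hopf_frame_normal.

(* [Phi]: the framed loop (γ, V) with γ' = q^bar i q and V = q^bar j q / |q|^2,
   based at γ(0) = 0. *)
Definition cls : Moduli := framed_class framed_loop_of.

End FramedLoopOfStiefel.

Arguments cls {k} P.

(** * Tangent vectors, symplectic form and derivatives on the moduli space *)

Definition horizontal {k} (P : St k) (D : path) : Prop :=
  inV2 k D /\
  L2 (fun t => fst (P t)) (fun t => fst (D t)) = RtoC 0 /\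
  L2 (fun t => snd (P t)) (fun t => snd (D t)) = RtoC 0 /\
  L2 (fun t => fst (P t)) (fun t => snd (D t)) = RtoC 0 /\
  L2 (fun t => snd (P t)) (fun t => fst (D t)) = RtoC 0.

Definition omega (D E : path) : R := - Im (L2pair D E).

Definition path_sub (Y X : path) : path :=
  fun t => ((fst (Y t) - fst (X t))%C, (snd (Y t) - snd (X t))%C).

(* X is the L^2-orthogonal projection of Y to the horizontal space at P. *)
Definition is_proj {k} (P : St k) (Y X : path) : Prop :=
  horizontal P X /\ forall W, horizontal P W -> L2pair (path_sub Y X) W = RtoC 0.

Definition smooth_curve {k} (c : R -> St k) : Prop :=
  smooth2 (fun s t => Re (fst (c s t))) /\ smooth2 (fun s t => Im (fst (c s t))) /\
  smooth2 (fun s t => Re (snd (c s t))) /\ smooth2 (fun s t => Im (snd (c s t))).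

Definition curve_through {k} (c : R -> St k) (P : St k) (D : path) : Prop :=
  smooth_curve c /\
  (forall t, c 0 t = P t) /\
  (forall t, D t = (CDerive (fun s => fst (c s t)) 0, CDerive (fun s => snd (c s t)) 0)).

(* The moduli space carries the smooth structure of the Grassmannians of 2-frames,
   so its smooth curves are the classes of smooth curves of Stiefel pairs.
   Df([P])(D) = l, where the horizontal vector D represents a tangent vector at
   [P]: f has derivative l along every smooth curve of classes [c s] with
   c 0 = P and c'(0) = D, and there is such a curve. *)
Definition is_differential (f : Moduli -> R) {k} (P : St k) (D : path) (l : R) : Prop :=
  (exists c : R -> St k, curve_through c P D) /\
  forall c : R -> St k, curve_through c P D ->
    is_derive (fun s => f (cls (c s))) 0 l.

(** * Reparameterizations *)

(* Lifts to the line of the orientation-preserving diffeomorphisms of S^1. *)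
Record Diff := mkDiff {
  dif :> R -> R;
  dif_smooth : smooth dif;
  dif_period : forall t, dif (t + 2) = dif t + 2;
  dif_pos : forall t, 0 < Derive dif t
}.

Definition act_path (r : Diff) (P : path) : path := fun t =>
  ((RtoC (sqrt (Derive r t)) * fst (P (r t)))%C,
   (RtoC (sqrt (Derive r t)) * snd (P (r t)))%C).

(* (1/2) xi' Phi + xi Phi', the velocity at s = 0 of sqrt(r_s') Phi o r_s when
   r_0 = id and xi is the velocity of r_s at s = 0; see [generator_velocity]. *)
Definition generator (xi : LoopR) (P : path) : path := fun t =>
  ((RtoC (/ 2 * Derive xi t) * fst (P t) + RtoC (xi t) * CDerive (fun u => fst (P u)) t)%C,
   (RtoC (/ 2 * Derive xi t) * snd (P t) + RtoC (xi t) * CDerive (fun u => snd (P u)) t)%C).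

(* X represents the induced vector field of xi at [P]. *)
Definition induced_field (xi : LoopR) {k} (P : St k) (X : path) : Prop :=
  is_proj P (generator xi P) X.

(** * The action on framed loops corresponds to the action on pairs *)

Section Action.

Variable r : Diff.

Lemma Derive_dif_period t : Derive r (t + 2) = Derive r t.
Proof.
assert (H : Derive (fun t => r (t + 2)) t = Derive (fun t => r t + 2) t)
  by (apply Derive_ext; intros u; apply dif_period).
rewrite (Derive_comp r (fun t => t + 2)) in H.
- rewrite Derive_plus, Derive_const, Derive_id in H.
  + rewrite Derive_plus, Derive_const in H; [lra| |apply ex_derive_const].
    apply smooth_ex_derive, dif_smooth.
  + apply ex_derive_id.
  + apply ex_derive_const.
- apply smooth_ex_derive, dif_smooth.
- auto_derive; exact I.
Qed.

Lemma smoothv_comp g : smoothv g -> smoothv (fun t => g (r t)).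
Proof.
intros [Hx [Hy Hz]]; repeat split.
- apply (smooth_comp (fun u => vx (g u)) r Hx), dif_smooth.
- apply (smooth_comp (fun u => vy (g u)) r Hy), dif_smooth.
- apply (smooth_comp (fun u => vz (g u)) r Hz), dif_smooth.
Qed.

Lemma vDerive_comp g t : smoothv g ->
  vDerive (fun t => g (r t)) t = vscal (Derive r t) (vDerive g (r t)).
Proof.
intros [Hx [Hy Hz]]; unfold vDerive, vscal; f_equal; [f_equal|].
- apply (Derive_comp (fun u => vx (g u)) r);
    apply smooth_ex_derive; [exact Hx|apply dif_smooth].
- apply (Derive_comp (fun u => vy (g u)) r);
    apply smooth_ex_derive; [exact Hy|apply dif_smooth].
- apply (Derive_comp (fun u => vz (g u)) r);
    apply smooth_ex_derive; [exact Hz|apply dif_smooth].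
Qed.

Section ActFramed.

Variable F : FramedLoop.

Lemma act_curve_period t : curve F (r (t + 2)) = curve F (r t).
Proof. now rewrite dif_period, curve_period. Qed.

Lemma act_frame_period t : frame F (r (t + 2)) = frame F (r t).
Proof. now rewrite dif_period, frame_period. Qed.

Lemma act_curve_immersion t : vDerive (fun t => curve F (r t)) t <> (0, 0, 0).
Proof.
rewrite vDerive_comp by apply curve_smooth; intros H.
apply (curve_immersion F (r t)).
assert (H0 := dif_pos r t).
destruct (vDerive (curve F) (r t)) as [[x y] z].
unfold vscal, vx, vy, vz in H; simpl in H; injection H; intros E3 E2 E1.
repeat f_equal; nra.
Qed.

Lemma act_frame_normal t : vdot (frame F (r t)) (vDerive (fun t => curve F (r t)) t) = 0.
Proof.
rewrite vDerive_comp by apply curve_smooth.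
transitivity (Derive r t * vdot (frame F (r t)) (vDerive (curve F) (r t))).
- unfold vdot, vscal, vx, vy, vz; simpl; ring.
- rewrite frame_normal; ring.
Qed.

Definition act_framed : FramedLoop :=
  mkFramedLoop (fun t => curve F (r t)) (fun t => frame F (r t))
    (smoothv_comp _ (curve_smooth F)) (smoothv_comp _ (frame_smooth F))
    act_curve_period act_frame_period act_curve_immersion
    (fun t => frame_unit F (r t)) act_frame_normal.

Lemma tangent_act t : tangent act_framed t = tangent F (r t).
Proof.
unfold tangent; simpl; rewrite vDerive_comp by apply curve_smooth.
assert (H0 := dif_pos r t).
assert (N : 0 < vnorm (vDerive (curve F) (r t))).
{ assert (I := curve_immersion F (r t)).
  destruct (vDerive (curve F) (r t)) as [[x y] z].
  apply sqrt_lt_R0; unfold vdot, vx, vy, vz; simpl.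
  destruct (Req_dec x 0) as [->|]; [|nra].
  destruct (Req_dec y 0) as [->|]; [|nra].
  destruct (Req_dec z 0) as [->|]; [now elim I|nra]. }
set (v := vDerive (curve F) (r t)) in *.
assert (E : vnorm (vscal (Derive r t) v) = Derive r t * vnorm v).
{ unfold vnorm.
  transitivity (sqrt (Derive r t * Derive r t) * sqrt (vdot v v));
    [|now rewrite sqrt_square by lra].
  rewrite <- sqrt_mult_alt by nra; f_equal.
  unfold vdot, vscal, vx, vy, vz; simpl; ring. }
rewrite E; unfold vscal, vx, vy, vz; simpl.
f_equal; [f_equal|]; field; lra.
Qed.

End ActFramed.

Lemma act_framed_move F G : framed_move F G -> framed_move (act_framed F) (act_framed G).
Proof.
intros [v H1 H2|A HA H1 H2|a Ha H1 H2|th H1 H2].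
- apply (move_translate _ _ v); intros t; [apply H1|apply H2].
- apply (move_rotate _ _ A HA); intros t; [apply H1|apply H2].
- apply (move_scale _ _ a Ha); intros t; [apply H1|apply H2].
- apply (move_spin _ _ th); intros t; [apply H1|].
  rewrite tangent_act; apply H2.
Qed.

(* The action of r descends to the moduli space. *)
Lemma act_framed_equiv F G : framed_equiv F G -> framed_equiv (act_framed F) (act_framed G).
Proof.
induction 1 as [F G H|F|F G _ IH|F G H _ IH1 _ IH2].
- now apply rst_step, act_framed_move.
- apply rst_refl.
- now apply rst_sym.
- now apply (rst_trans _ _ _ (act_framed G)).
Qed.

Section ActStiefel.

Variables (k : kind) (P : St k).

Lemma smooth_sqrt_dif : smooth (fun t => sqrt (Derive r t)).
Proof. apply smooth_sqrt; [apply dif_pos|apply smooth_Derive, dif_smooth]. Qed.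

Lemma act_inV f : inV k f -> inV k (fun t => (RtoC (sqrt (Derive r t)) * f (r t))%C).
Proof.
intros [[H1 H2] Hp]; split.
- split; unfold Re, Im; simpl.
  + apply (smooth_ext (fun t => sqrt (Derive r t) * Re (f (r t)))).
    * intros t; unfold Re, Im; ring.
    * apply smooth_mult; [apply smooth_sqrt_dif|].
      apply (smooth_comp (fun u => Re (f u)) r H1), dif_smooth.
  + apply (smooth_ext (fun t => sqrt (Derive r t) * Im (f (r t)))).
    * intros t; unfold Re, Im; ring.
    * apply smooth_mult; [apply smooth_sqrt_dif|].
      apply (smooth_comp (fun u => Im (f u)) r H2), dif_smooth.
- intros t; rewrite Derive_dif_period, dif_period, Hp; ring.
Qed.

Lemma RInt_act h : smooth h -> (forall t, h (t + 2) = h t) ->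
  RInt (fun t => Derive r t * h (r t)) 0 2 = RInt h 0 2.
Proof.
intros Hh Hp.
rewrite <- (RInt_period h (r 0)) by assumption.
replace (r 0 + 2) with (r 2) by (rewrite <- dif_period; f_equal; ring).
apply (RInt_comp (V := R_CompleteNormedModule) h r (Derive r)).
- intros x _; now apply smooth_continuous.
- intros x _; split.
  + apply Derive_correct, smooth_ex_derive, dif_smooth.
  + apply smooth_continuous, smooth_Derive, dif_smooth.
Qed.

Lemma act_L2 f g : inV k f -> inV k g ->
  L2 (fun t => (RtoC (sqrt (Derive r t)) * f (r t))%C)
     (fun t => (RtoC (sqrt (Derive r t)) * g (r t))%C) = L2 f g.
Proof.
intros Hf Hg.
assert (Hs : forall t, sqrt (Derive r t) * sqrt (Derive r t) = Derive r t)
  by (intros t; apply sqrt_sqrt; left; apply dif_pos).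
rewrite (L2E _ _ (proj1 (act_inV f Hf)) (proj1 (act_inV g Hg))).
destruct Hf as [[F1 F2] Fp], Hg as [[G1 G2] Gp].
rewrite (L2E f g) by now split.
f_equal.
- rewrite <- (RInt_act (fun t => Re (f t) * Re (g t) + Im (f t) * Im (g t))).
  + apply RInt_ext; intros t _; assert (E := Hs t); unfold Re, Im; simpl.
    set (s := sqrt (Derive r t)) in *; rewrite <- E; ring.
  + smooth_tac.
  + intros t; rewrite Fp, Gp; destruct k; unfold Re, Im; simpl; ring.
- rewrite <- (RInt_act (fun t => Im (f t) * Re (g t) - Re (f t) * Im (g t))).
  + apply RInt_ext; intros t _; assert (E := Hs t); unfold Re, Im; simpl.
    set (s := sqrt (Derive r t)) in *; rewrite <- E; ring.
  + smooth_tac.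
  + intros t; rewrite Fp, Gp; destruct k; unfold Re, Im; simpl; ring.
Qed.

Lemma act_inV2 : inV2 k (act_path r P).
Proof. 
destruct (st_inV2 k P) as [H1 H2]; split;
  [exact (act_inV _ H1)|exact (act_inV _ H2)].
Qed.

Lemma act_norm1 :
  L2 (fun t => fst (act_path r P t)) (fun t => fst (act_path r P t)) = RtoC 1.
Proof.
rewrite <- (st_norm1 k P); destruct (st_inV2 k P) as [H1 _]; exact (act_L2 _ _ H1 H1).
Qed.

Lemma act_norm2 :
  L2 (fun t => snd (act_path r P t)) (fun t => snd (act_path r P t)) = RtoC 1.
Proof.
rewrite <- (st_norm2 k P); destruct (st_inV2 k P) as [_ H2]; exact (act_L2 _ _ H2 H2).
Qed.

Lemma act_orth :
  L2 (fun t => fst (act_path r P t)) (fun t => snd (act_path r P t)) = RtoC 0.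
Proof.
rewrite <- (st_orth k P); destruct (st_inV2 k P) as [H1 H2]; exact (act_L2 _ _ H1 H2).
Qed.

Lemma act_nonzero t : act_path r P t <> (RtoC 0, RtoC 0).
Proof.
intros H; apply (st_nonzero k P (r t)).
assert (H0 := sqrt_lt_R0 _ (dif_pos r t)).
unfold act_path in H; destruct (P (r t)) as [[x y] [z w]].
simpl in H; unfold Cmult, RtoC in *; simpl in H.
injection H; intros E4 E3 E2 E1.
repeat f_equal; nra.
Qed.

Definition act_St : St k :=
  mkSt k (act_path r P) act_inV2 act_norm1 act_norm2 act_orth act_nonzero.

Lemma act_hopf_velocity t :
  hopf_velocity (act_path r P t) = vscal (Derive r t) (hopf_velocity (P (r t))).
Proof.
assert (Hs : sqrt (Derive r t) * sqrt (Derive r t) = Derive r t)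
  by (apply sqrt_sqrt; left; apply dif_pos).
rewrite !hopf_velocityE; unfold act_path, vscal, vx, vy, vz, Re, Im; simpl.
set (s := sqrt (Derive r t)) in *; rewrite <- Hs.
f_equal; [f_equal|]; ring.
Qed.

Lemma act_hopf_frame t : hopf_frame (act_path r P t) = hopf_frame (P (r t)).
Proof.
assert (H0 := sqrt_lt_R0 _ (dif_pos r t)).
assert (N := qnorm2_gt0 _ (st_nonzero k P (r t))).
rewrite !hopf_frameE.
replace (qnorm2 (act_path r P t))
  with (sqrt (Derive r t) * sqrt (Derive r t) * qnorm2 (P (r t)))
  by (rewrite !qnorm2E; unfold act_path, Re, Im; simpl; ring).
set (n := qnorm2 (P (r t))) in *.
unfold act_path, vscal, vx, vy, vz, Re, Im in *; simpl in *.
f_equal; [f_equal|]; field; split; lra.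
Qed.

Lemma framed_loop_of_act :
  framed_move (act_framed (framed_loop_of k P)) (framed_loop_of k act_St).
Proof.
apply (move_translate _ _ (vscal (-1) (hopf_curve k P (r 0)))); intros t; simpl;
  [|apply act_hopf_frame].
destruct (st_hopf_velocity_smooth k P) as [Hx [Hy Hz]].
assert (H : forall f, smooth f ->
  RInt (fun u => Derive r u * f (r u)) 0 t = RInt f 0 (r t) + -1 * RInt f 0 (r 0)).
{ intros f Hf.
  transitivity (RInt f (r 0) (r t)).
  - apply (RInt_comp (V := R_CompleteNormedModule) f r (Derive r)).
    + intros x _; now apply smooth_continuous.
    + intros x _; split.
      * apply Derive_correct, smooth_ex_derive, dif_smooth.
      * apply smooth_continuous, smooth_Derive, dif_smooth.
  - assert (C := RInt_Chasles f 0 (r 0) (r t) (smooth_ex_RInt f _ _ Hf) (smooth_ex_RInt f _ _ Hf)).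
    change (RInt f 0 (r 0) + RInt f (r 0) (r t) = RInt f 0 (r t)) in C; lra. }
unfold hopf_curve, vRInt, vadd, vscal; f_equal; [f_equal|].
- set (f := fun u => vx (hopf_velocity (P u))).
  change (RInt (fun u => vx (hopf_velocity (act_path r P u))) 0 t
          = RInt f 0 (r t) + -1 * RInt f 0 (r 0)); rewrite <- H by exact Hx.
  apply RInt_ext; intros u _; now rewrite act_hopf_velocity.
- set (f := fun u => vy (hopf_velocity (P u))).
  change (RInt (fun u => vy (hopf_velocity (act_path r P u))) 0 t
          = RInt f 0 (r t) + -1 * RInt f 0 (r 0)); rewrite <- H by exact Hy.
  apply RInt_ext; intros u _; now rewrite act_hopf_velocity.
- set (f := fun u => vz (hopf_velocity (P u))).
  change (RInt (fun u => vz (hopf_velocity (act_path r P u))) 0 t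
          = RInt f 0 (r t) + -1 * RInt f 0 (r 0)); rewrite <- H by exact Hz.
  apply RInt_ext; intros u _; now rewrite act_hopf_velocity.
Qed.

End ActStiefel.

End Action.

Section Velocity.

Variables (xi : LoopR) (r : R -> Diff).
Hypothesis r_smooth : smooth2 (fun s t => r s t).
Hypothesis r_id : forall t, r 0 t = t.
Hypothesis r_velocity : forall t, Derive (fun s => r s t) 0 = xi t.

Lemma act_velocity f t : smooth f ->
  is_derive (fun s => sqrt (Derive (r s) t) * f (r s t)) 0
            (/ 2 * Derive xi t * f t + xi t * Derive f t).
Proof.
intros Hf.
assert (D1 : is_derive (fun s => r s t) 0 (xi t)).
{ rewrite <- r_velocity; apply Derive_correct.
  now destruct (r_smooth 1%nat 0 t) as [_ [H _]]. }
assert (D2 : is_derive (fun s => Derive (r s) t) 0 (Derive xi t)).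
{ assert (E : Derive xi t = Derive (fun s => Derive (fun u => r s u) t) 0).
  { rewrite (Schwarz (fun s u => r s u)).
    - apply Derive_ext; intros u; now rewrite r_velocity.
    - apply locally_2d_forall; intros s u.
      destruct (r_smooth 2%nat s u) as [_ [H1 [H2 [[_ [_ [H3 _]]] [_ [H4 _]]]]]].
      now repeat split.
    - now destruct (r_smooth 2%nat 0 t) as [_ [_ [_ [_ [_ [_ [_ [[H _] _]]]]]]]].
    - now destruct (r_smooth 2%nat 0 t) as [_ [_ [_ [[_ [_ [_ [_ [H _]]]]] _]]]]. }
  rewrite E; apply Derive_correct.
  now destruct (r_smooth 2%nat 0 t) as [_ [_ [_ [_ [_ [H _]]]]]]. }
assert (V : Derive (r 0) t = 1).
{ rewrite (Derive_ext (r 0) (fun u => u)) by exact r_id; apply Derive_id. }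
assert (D3 : is_derive (fun s => sqrt (Derive (r s) t)) 0 (/ 2 * Derive xi t)).
{ assert (H := is_derive_sqrt _ _ _ D2 (dif_pos (r 0) t)).
  simpl in H; rewrite V, sqrt_1 in H.
  replace (/ 2 * Derive xi t) with (Derive xi t / (2 * 1)) by field; exact H. }
assert (D4 : is_derive (fun s => f (r s t)) 0 (xi t * Derive f t)).
{ apply (is_derive_comp f (fun s => r s t)); [|exact D1].
  rewrite r_id; now apply Derive_correct, smooth_ex_derive. }
assert (H := is_derive_mult _ _ _ _ _ D3 D4 Rmult_comm).
simpl in H; rewrite V, sqrt_1, r_id in H.
replace (/ 2 * Derive xi t * f t + xi t * Derive f t)
  with (/ 2 * Derive xi t * f t + 1 * (xi t * Derive f t)) by ring.
exact H.
Qed.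

Lemma generator_velocity k (P : St k) t :
  generator xi P t =
  (CDerive (fun s => fst (act_path (r s) P t)) 0,
   CDerive (fun s => snd (act_path (r s) P t)) 0).
Proof.
assert (HC : forall f, smoothC f ->
  (RtoC (/ 2 * Derive xi t) * f t + RtoC (xi t) * CDerive f t)%C
  = CDerive (fun s => (RtoC (sqrt (Derive (r s) t)) * f (r s t))%C) 0).
{ intros f [H1 H2]; unfold CDerive.
  rewrite (Derive_ext (fun s => Re (RtoC (sqrt (Derive (r s) t)) * f (r s t))%C)
             (fun s => sqrt (Derive (r s) t) * Re (f (r s t))))
    by (intros s; unfold Re; simpl; ring).
  rewrite (Derive_ext (fun s => Im (RtoC (sqrt (Derive (r s) t)) * f (r s t))%C)
             (fun s => sqrt (Derive (r s) t) * Im (f (r s t))))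
    by (intros s; unfold Im; simpl; ring).
  assert (EH1 := is_derive_unique _ _ _ (act_velocity (fun u => Re (f u)) t H1)).
  change (Derive (fun s => sqrt (Derive (r s) t) * Re (f (r s t))) 0
    = / 2 * Derive xi t * Re (f t) + xi t * Derive (fun u => Re (f u)) t) in EH1.
  rewrite EH1.
  assert (EH2 := is_derive_unique _ _ _ (act_velocity (fun u => Im (f u)) t H2)).
  change (Derive (fun s => sqrt (Derive (r s) t) * Im (f (r s t))) 0
    = / 2 * Derive xi t * Im (f t) + xi t * Derive (fun u => Im (f u)) t) in EH2.
  rewrite EH2.
  unfold Cplus, Cmult, RtoC, Re, Im; simpl; f_equal; ring. }
destruct (st_inV2 k P) as [[H1 _] [H2 _]].
unfold generator; f_equal.
- exact (HC (fun u => fst (P u)) H1).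
- exact (HC (fun u => snd (P u)) H2).
Qed.

End Velocity.

(** * Loops and antiloops as functions on [0,2] *)

Lemma inV_endpoints k f : inV k f -> forall n,
  Derive_n (fun t => Re (f t)) n 2 = sign k * Derive_n (fun t => Re (f t)) n 0 /\
  Derive_n (fun t => Im (f t)) n 2 = sign k * Derive_n (fun t => Im (f t)) n 0.
Proof.
intros [_ Hp].
assert (H : forall h : R -> R, (forall t, h (t + 2) = sign k * h t) ->
  forall n, Derive_n h n 2 = sign k * Derive_n h n 0).
{ intros h Hh n.
  rewrite <- Derive_n_scal_l, <- (Rplus_0_l 2), <- Derive_n_comp_trans.
  now apply Derive_n_ext. }
intros n; split; apply H; intros t; rewrite Hp; unfold Re, Im; simpl; ring.
Qed.

Section Extension.

Variable e : R.
Hypothesis e2 : e * e = 1.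

Definition cell (t : R) : Z := Int_part (t / 2).

Lemma cell_bounds t : 2 * IZR (cell t) <= t < 2 * IZR (cell t) + 2.
Proof. unfold cell; destruct (base_Int_part (t / 2)); lra. Qed.

Lemma cell_unique t m : 2 * IZR m <= t < 2 * IZR m + 2 -> cell t = m.
Proof. intros H; symmetry; apply Int_part_spec; lra. Qed.

Definition extension (g : R -> R) (t : R) : R :=
  powerRZ e (cell t) * g (t - 2 * IZR (cell t)).

Lemma e_neq0 : e <> 0.
Proof. intros E; rewrite E in e2; lra. Qed.

Lemma extension_shift g m t : extension g t = powerRZ e m * extension g (t - 2 * IZR m).
Proof.
assert (H := cell_bounds t).
assert (E : cell (t - 2 * IZR m) = (cell t - m)%Z)
  by (apply cell_unique; rewrite minus_IZR; lra).
unfold extension; rewrite E, minus_IZR, <- Rmult_assoc.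
rewrite <- powerRZ_add by exact e_neq0.
f_equal; f_equal; [lia|ring].
Qed.

Lemma extension_period g t : extension g (t + 2) = e * extension g t.
Proof.
rewrite (extension_shift g 1 (t + 2)).
rewrite powerRZ_1; do 2 f_equal; simpl; ring.
Qed.

Lemma extension_in g t : 0 <= t < 2 -> extension g t = g t.
Proof.
intros H; unfold extension; rewrite (cell_unique t 0) by (simpl; lra).
rewrite powerRZ_O; simpl; rewrite Rmult_1_l; f_equal; ring.
Qed.

Lemma is_derive_glue (f g h : R -> R) (x l : R) : f x = g x -> f x = h x ->
  (exists d, 0 < d /\ forall t, x - d < t < x -> f t = h t) ->
  (exists d, 0 < d /\ forall t, x < t < x + d -> f t = g t) ->
  is_derive g x l -> is_derive h x l -> is_derive f x l.
Proof.
intros Eg Eh [d1 [H1 Hh]] [d2 [H2 Hg]] Dg Dh.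
rewrite is_derive_Reals in *; intros eps Heps.
destruct (Dg eps Heps) as [a Ha], (Dh eps Heps) as [b Hb].
assert (Hd : 0 < Rmin (Rmin a b) (Rmin d1 d2))
  by (repeat apply Rmin_pos; try assumption; apply cond_pos).
exists (mkposreal _ Hd); simpl; intros u Hu Hlt.
assert (L1 := Rle_trans _ _ _ (Rmin_l (Rmin a b) (Rmin d1 d2)) (Rmin_l a b)).
assert (L2 := Rle_trans _ _ _ (Rmin_l (Rmin a b) (Rmin d1 d2)) (Rmin_r a b)).
assert (L3 := Rle_trans _ _ _ (Rmin_r (Rmin a b) (Rmin d1 d2)) (Rmin_l d1 d2)).
assert (L4 := Rle_trans _ _ _ (Rmin_r (Rmin a b) (Rmin d1 d2)) (Rmin_r d1 d2)).
assert (U := Rabs_def2 _ _ Hlt).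
destruct (Rlt_le_dec u 0) as [Hn|Hn].
- rewrite Hh, Eh by lra; apply Hb; [exact Hu|apply Rabs_def1; lra].
- assert (0 < u) by (destruct Hn; [assumption|congruence]).
  rewrite Hg, Eg by lra; apply Ha; [exact Hu|apply Rabs_def1; lra].
Qed.

Lemma is_derive_extension g t :
  smooth g -> g 2 = e * g 0 -> Derive g 2 = e * Derive g 0 ->
  is_derive (extension g) t (extension (Derive g) t).
Proof.
intros Hg E0 E1.
assert (Hin : forall t, 0 <= t < 2 -> is_derive (extension g) t (extension (Derive g) t)).
{ clear t; intros t Ht.
  rewrite (extension_in (Derive g)) by exact Ht.
  assert (Dg := Derive_correct _ _ (smooth_ex_derive _ t Hg)).
  destruct (proj1 Ht) as [Ht0|Ht0].
  - apply (is_derive_ext_loc g); [|exact Dg].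
    assert (Hd : 0 < Rmin t (2 - t)) by (apply Rmin_pos; lra).
    exists (mkposreal _ Hd); intros u Hu.
    symmetry; apply extension_in.
    assert (L1 := Rmin_l t (2 - t)); assert (L2 := Rmin_r t (2 - t)).
    apply Rabs_def2 in Hu; simpl in Hu; unfold minus, plus, opp in Hu; simpl in Hu; lra.
  - subst t.
    apply (is_derive_glue _ g (fun t => e * g (t + 2))).
    + apply extension_in; lra.
    + rewrite extension_in by lra; rewrite Rplus_0_l, E0, <- Rmult_assoc, e2; ring.
    + exists 2; split; [lra|]; intros t Ht'.
      rewrite (extension_shift g (-1)); simpl IZR.
      rewrite extension_in by lra.
      replace (powerRZ e (-1)) with e.
      * do 2 f_equal; ring.
      * simpl; rewrite Rmult_1_r; apply (Rmult_eq_reg_l e); [|exact e_neq0].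
        rewrite e2; field; exact e_neq0.
    + exists 2; split; [lra|]; intros t Ht'; apply extension_in; lra.
    + exact Dg.
    + assert (D2 := Derive_correct _ _ (smooth_ex_derive _ 2 Hg)).
      replace (Derive g 0) with (e * (1 * Derive g 2))
        by (rewrite E1; rewrite Rmult_1_l, <- Rmult_assoc, e2; ring).
      apply (is_derive_scal (fun t => g (t + 2))).
      apply (is_derive_comp g (fun t => t + 2)).
      * now rewrite Rplus_0_l.
      * auto_derive; [exact I|ring]. }
set (m := cell t).
rewrite (extension_shift (Derive g) m).
apply (is_derive_ext (fun u => powerRZ e m * extension g (u - 2 * IZR m))).
- intros u; symmetry; apply extension_shift.
- apply (is_derive_scal (fun u => extension g (u - 2 * IZR m))).
  rewrite <- (Rmult_1_l (extension (Derive g) _)).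
  apply (is_derive_comp (extension g) (fun u => u - 2 * IZR m)).
  + apply Hin; assert (H := cell_bounds t); unfold m; lra.
  + auto_derive; [exact I|ring].
Qed.

Lemma extension_smooth g : smooth g ->
  (forall n, Derive_n g n 2 = e * Derive_n g n 0) -> smooth (extension g).
Proof.
intros Hg He; apply smoothP; intros n.
revert g Hg He; induction n as [|n IH]; intros g Hg He; [exact I|].
assert (D := fun t => is_derive_extension g t Hg (He 0%nat) (He 1%nat)).
split; [intros t; eexists; apply D|].
apply (Ck_ext _ (extension (Derive g))).
- intros t; symmetry; apply is_derive_unique, D.
- apply IH; [now apply smooth_Derive|].
  intros k; change (Derive g) with (Derive_n g 1); rewrite !Derive_n_comp; apply He.
Qed.

Lemma extension_eq g t : g 2 = e * g 0 -> 0 <= t <= 2 -> extension g t = g t.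
Proof.
intros E [H1 H2]; destruct H2 as [H2|H2]; [apply extension_in; lra|].
subst t; rewrite E; replace 2 with (0 + 2) at 1 by ring.
rewrite extension_period, extension_in by lra; reflexivity.
Qed.

Lemma extension_unique f t : (forall t, f (t + 2) = e * f t) -> f t = extension f t.
Proof.
intros Hf.
assert (Hm : forall n t, f (t + 2 * INR n) = e ^ n * f t).
{ induction n as [|n IH]; intros u.
  - simpl; rewrite Rmult_1_l; f_equal; ring.
  - rewrite S_INR; replace (u + 2 * (INR n + 1)) with ((u + 2 * INR n) + 2) by ring.
    rewrite Hf, IH; simpl; ring. }
unfold extension; set (m := cell t); set (u := t - 2 * IZR m).
replace t with (u + 2 * IZR m) by (unfold u; ring); clearbody u m.
destruct m as [|p|p]; simpl powerRZ.
- rewrite Rmult_1_l; f_equal; simpl; ring.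
- rewrite <- Hm, INR_IPR; reflexivity.
- assert (H := Hm (Pos.to_nat p) (u + 2 * IZR (Z.neg p))).
  rewrite INR_IPR in H.
  replace (u + 2 * IZR (Z.neg p) + 2 * IPR p) with u in H
    by (unfold IZR; simpl; ring).
  rewrite H, <- Rmult_assoc, Rinv_l, Rmult_1_l; [reflexivity|].
  apply pow_nonzero, e_neq0.
Qed.

End Extension.

Lemma inV_extension k g : smoothC g ->
  (forall n,
     Derive_n (fun t => Re (g t)) n 2 = sign k * Derive_n (fun t => Re (g t)) n 0 /\
     Derive_n (fun t => Im (g t)) n 2 = sign k * Derive_n (fun t => Im (g t)) n 0) ->
  (exists f, inV k f /\ forall t, 0 <= t <= 2 -> f t = g t) /\
  forall f1 f2, inV k f1 -> inV k f2 ->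
    (forall t, 0 <= t <= 2 -> f1 t = g t) -> (forall t, 0 <= t <= 2 -> f2 t = g t) ->
    forall t, f1 t = f2 t.
Proof.
intros [H1 H2] He.
assert (e2 : sign k * sign k = 1) by (destruct k; simpl; ring).
split.
- exists (fun t => (extension (sign k) (fun t => Re (g t)) t,
                    extension (sign k) (fun t => Im (g t)) t)).
  repeat split.
  + apply extension_smooth; [exact e2|exact H1|apply He].
  + apply extension_smooth; [exact e2|exact H2|apply He].
  + intros t; rewrite !extension_period by exact e2.
    unfold Cmult, RtoC; simpl; f_equal; ring.
  + intros t Ht; rewrite !extension_eq; try assumption; try apply (He 0%nat).
    now destruct (g t).
- intros f1 f2 [_ P1] [_ P2] E1 E2 t.
  assert (Q : forall f, (forall t, f (t + 2) = (RtoC (sign k) * f t)%C) ->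
    f t = (extension (sign k) (fun t => Re (f t)) t,
           extension (sign k) (fun t => Im (f t)) t)).
  { intros f Hf.
    rewrite <- (extension_unique _ e2 (fun t => Re (f t))).
    - rewrite <- (extension_unique _ e2 (fun t => Im (f t))).
      + now destruct (f t).
      + intros u; rewrite Hf; unfold Im; simpl; ring.
    - intros u; rewrite Hf; unfold Re; simpl; ring. }
  rewrite (Q f1 P1), (Q f2 P2); unfold extension.
  assert (B := cell_bounds t); rewrite E1, E2 by lra; reflexivity.
Qed.

(* Main.v *)
Require Import Defs.
From Stdlib Require Import Reals Lra Relations FunctionalExtensionality ClassicalEpsilon.
From Coquelicot Require Import Coquelicot.
Open Scope R_scope.

(** The momentum map has to be defined on framed loops modulo moves, although its formula is
    in terms of Stiefel pairs. The formula is a geometric quantity: for gamma' = conj(q) i q and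
    V = conj(q) j q / |q|^2, the function Im (phi' conj phi + psi' conj psi) is the i-component
    of q' conj(q), which is - (1/2) V' . (gamma' x V), and loops coming from Stiefel pairs have
    length 2. So - V' . (gamma' x V) / length, which is invariant under translations, rotations,
    scalings and constant rotations of V ([normalized_twist_move]), descends to the moduli space
    and restricts to the stated formula ([momentum_cls]).

    For the Hamiltonian identity, let c(s) be a curve of Stiefel pairs with velocity D at
    c(0) = P. Differentiating (1/2) int xi Im (phi' conj phi + psi' conj psi) under the integral
    sign and integrating by parts in t gives - Im < D, (1/2) xi' P + xi P' >
    ([momentum_variation]). When D is horizontal, the generator may be replaced by its horizontal
    projection ([omega_proj]), and this is omega(D, X_xi).

    It remains that every horizontal D is the velocity of some smooth curve of nowhere vanishing
    Stiefel pairs ([curve_exists]): orthonormalize P + sg(s) D, where sg is a bounded odd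
    parameter with sg'(0) = 1. *)

(** * Derivatives of functions of one variable *)

(** Goals produced by lemmas on normed modules carry a structure type that [ring] does not
    recognize as R. *)
Ltac real_ring := lazymatch goal with |- ?a = ?b => change (@eq R a b) end; ring.

Lemma smooth_correct f t : smooth f -> is_derive f t (Derive f t).
Proof. intros Hf; now apply Derive_correct, smooth_ex_derive. Qed.

Lemma is_derive_product p q (t dp dq : R) : is_derive p t dp -> is_derive q t dq ->
  is_derive (fun u => p u * q u) t (dp * q t + p t * dq).
Proof. intros Hp Hq; exact (is_derive_mult _ _ _ _ _ Hp Hq Rmult_comm). Qed.

Lemma Derive_quasiperiodic f e t : smooth f -> (forall u, f (u + 2) = e * f u) ->
  Derive f (t + 2) = e * Derive f t.
Proof.
intros Hf Hp; rewrite <- Derive_scal, <- (Derive_ext _ _ t Hp), (Derive_comp f (fun u => u + 2)).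
- rewrite Derive_plus, Derive_id, Derive_const;
    [ring|apply ex_derive_id|apply ex_derive_const].
- now apply smooth_ex_derive.
- auto_derive; exact I.
Qed.

(** * Jointly smooth functions of two variables *)

Definition partial1 (f : R -> R -> R) (s t : R) : R := Derive (fun u => f u t) s.
Definition partial2 (f : R -> R -> R) (s t : R) : R := Derive (f s) t.

(** Joint smoothness is the largest class of continuous functions with partial derivatives
    that is stable under both partial derivatives; any such class therefore consists of
    smooth functions. *)
Lemma smooth2_coind (S : (R -> R -> R) -> Prop) :
  (forall f, S f ->
     (forall s t, continuity_2d_pt f s t) /\
     (forall s t, ex_derive (fun u => f u t) s) /\
     (forall s t, ex_derive (f s) t) /\
     S (partial1 f) /\ S (partial2 f)) ->
  forall f, S f -> smooth2 f.
Proof.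
intros HS f Hf n; revert f Hf.
induction n as [|n IH]; intros f Hf s t; destruct (HS f Hf) as [C [E1 [E2 [S1 S2]]]].
- now split.
- repeat split; [apply C|apply E1|apply E2| |].
  + exact (IH _ S1 s t).
  + exact (IH _ S2 s t).
Qed.

Lemma smooth2_unfold f : smooth2 f ->
  (forall s t, continuity_2d_pt f s t) /\
  (forall s t, ex_derive (fun u => f u t) s) /\
  (forall s t, ex_derive (f s) t) /\
  smooth2 (partial1 f) /\ smooth2 (partial2 f).
Proof.
intros Hf; repeat split.
- intros s t; apply (Hf 0%nat).
- intros s t; now destruct (Hf 1%nat s t) as [_ [H _]].
- intros s t; now destruct (Hf 1%nat s t) as [_ [_ [H _]]].
- intros n s t; now destruct (Hf (S n) s t) as [_ [_ [_ [H _]]]].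
- intros n s t; now destruct (Hf (S n) s t) as [_ [_ [_ [_ H]]]].
Qed.

(** By the Leibniz rule, partial derivatives of members of this algebra stay in it, whereas
    the generators alone or their products alone are not stable. *)
Inductive smooth2_alg : (R -> R -> R) -> Prop :=
| alg_joint f : smooth2 f -> smooth2_alg f
| alg_first f : smooth f -> smooth2_alg (fun s _ => f s)
| alg_second f : smooth f -> smooth2_alg (fun _ t => f t)
| alg_plus f g : smooth2_alg f -> smooth2_alg g -> smooth2_alg (fun s t => f s t + g s t)
| alg_mult f g : smooth2_alg f -> smooth2_alg g -> smooth2_alg (fun s t => f s t * g s t).

Lemma fun_ext2 {T : Type} (f g : R -> R -> T) : (forall s t, f s t = g s t) -> f = g.
Proof.
intros H; apply functional_extensionality; intros s.
now apply functional_extensionality.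
Qed.

Lemma smooth2_algP f : smooth2_alg f -> smooth2 f.
Proof.
apply smooth2_coind; clear f; intros f Hf.
induction Hf as [f Hf|f Hf|f Hf|f g Af IHf Ag IHg|f g Af IHf Ag IHg].
- destruct (smooth2_unfold f Hf) as [C [E1 [E2 [S1 S2]]]].
  repeat split; try assumption; now apply alg_joint.
- repeat split.
  + intros s t; apply (continuity_1d_2d_pt_comp f (fun u _ => u)).
    * now apply continuity_pt_filterlim, smooth_continuous.
    * apply continuity_2d_pt_id1.
  + intros s t; now apply smooth_ex_derive.
  + intros s t; apply ex_derive_const.
  + now apply (alg_first (Derive f)), smooth_Derive.
  + replace (partial2 (fun s _ => f s)) with (fun _ _ : R => 0).
    * apply (alg_first (fun _ => 0)), smooth_const.
    * apply fun_ext2; intros s t; symmetry; unfold partial1, partial2; apply Derive_const.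
- repeat split.
  + intros s t; apply (continuity_1d_2d_pt_comp f (fun _ v => v)).
    * now apply continuity_pt_filterlim, smooth_continuous.
    * apply continuity_2d_pt_id2.
  + intros s t; apply ex_derive_const.
  + intros s t; now apply smooth_ex_derive.
  + replace (partial1 (fun _ t => f t)) with (fun _ _ : R => 0).
    * apply (alg_first (fun _ => 0)), smooth_const.
    * apply fun_ext2; intros s t; symmetry; unfold partial1, partial2; apply Derive_const.
  + now apply (alg_second (Derive f)), smooth_Derive.
- destruct IHf as [Cf [E1f [E2f [S1f S2f]]]], IHg as [Cg [E1g [E2g [S1g S2g]]]].
  repeat split.
  + intros s t; now apply continuity_2d_pt_plus.
  + intros s t; apply (ex_derive_plus (fun u => f u t) (fun u => g u t)); auto.
  + intros s t; apply (ex_derive_plus (f s) (g s)); auto.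
  + replace (partial1 _) with (fun s t => partial1 f s t + partial1 g s t); [now apply alg_plus|].
    apply fun_ext2; intros s t; symmetry.
    apply (Derive_plus (fun u => f u t) (fun u => g u t)); auto.
  + replace (partial2 _) with (fun s t => partial2 f s t + partial2 g s t); [now apply alg_plus|].
    apply fun_ext2; intros s t; symmetry; apply (Derive_plus (f s) (g s)); auto.
- destruct IHf as [Cf [E1f [E2f [S1f S2f]]]], IHg as [Cg [E1g [E2g [S1g S2g]]]].
  repeat split.
  + intros s t; now apply continuity_2d_pt_mult.
  + intros s t; apply (ex_derive_mult (fun u => f u t) (fun u => g u t)); auto.
  + intros s t; apply (ex_derive_mult (f s) (g s)); auto.
  + replace (partial1 _) with (fun s t => partial1 f s t * g s t + f s t * partial1 g s t);
      [now apply alg_plus; apply alg_mult|].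
    apply fun_ext2; intros s t; symmetry.
    apply (Derive_mult (fun u => f u t) (fun u => g u t)); auto.
  + replace (partial2 _) with (fun s t => partial2 f s t * g s t + f s t * partial2 g s t);
      [now apply alg_plus; apply alg_mult|].
    apply fun_ext2; intros s t; symmetry; apply (Derive_mult (f s) (g s)); auto.
Qed.

Lemma smooth2_first f : smooth f -> smooth2 (fun s _ => f s).
Proof. intros H; now apply smooth2_algP, alg_first. Qed.

Lemma smooth2_second f : smooth f -> smooth2 (fun _ t => f t).
Proof. intros H; now apply smooth2_algP, alg_second. Qed.

Lemma smooth2_plus f g : smooth2 f -> smooth2 g -> smooth2 (fun s t => f s t + g s t).
Proof. intros Hf Hg; now apply smooth2_algP, alg_plus; apply alg_joint. Qed.

Lemma smooth2_mult f g : smooth2 f -> smooth2 g -> smooth2 (fun s t => f s t * g s t).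
Proof. intros Hf Hg; now apply smooth2_algP, alg_mult; apply alg_joint. Qed.

Lemma smooth2_slice2 f s : smooth2 f -> smooth (f s).
Proof.
intros Hf; apply smoothP; intros n; revert f Hf.
induction n as [|n IH]; intros f Hf; [exact I|].
destruct (smooth2_unfold f Hf) as [_ [_ [E2 [_ S2]]]].
split; [intros t; apply E2|exact (IH _ S2)].
Qed.

Lemma partial_commute f s t : smooth2 f -> partial1 (partial2 f) s t = partial2 (partial1 f) s t.
Proof.
intros Hf; destruct (smooth2_unfold f Hf) as [_ [E1 [E2 [S1 S2]]]].
destruct (smooth2_unfold _ S1) as [_ [_ [E12 [_ S12]]]].
destruct (smooth2_unfold _ S2) as [_ [E21 [_ [S21 _]]]].
apply (Schwarz f).
- apply locally_2d_forall; intros u v; repeat split;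
    [apply E1|apply E2|apply E21|apply E12].
- now apply smooth2_unfold.
- now apply smooth2_unfold.
Qed.

Lemma is_derive_RInt_smooth2 f a b s : smooth2 f ->
  is_derive (fun u => RInt (f u) a b) s (RInt (partial1 f s) a b).
Proof.
intros Hf; destruct (smooth2_unfold f Hf) as [_ [E1 [_ [S1 _]]]].
apply (is_derive_RInt_param f).
- apply filter_forall; intros u t _; apply E1.
- intros t _; now apply (smooth2_unfold (partial1 f)).
- apply filter_forall; intros u; now apply smooth_ex_RInt, smooth2_slice2.
Qed.

(** * First variation of the momentum *)

(** Im (z' conj z) for z = f + i g. *)
Definition area_density (f g : R -> R) (t : R) : R := Derive g t * f t - Derive f t * g t.

(** Serves twice: for the boundary flux as a function of t and for the integrand of the
    momentum pairing as a function of s. *)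
Lemma is_derive_det (p q p' q' x : R -> R) (s dp dq dp' dq' dx : R) :
  is_derive p s dp -> is_derive q s dq -> is_derive p' s dp' -> is_derive q' s dq' ->
  is_derive x s dx ->
  is_derive (fun u => (p u * q u + (-1) * (p' u * q' u)) * x u) s
    ((dp * q s + p s * dq - (dp' * q' s + p' s * dq')) * x s
     + (p s * q s - p' s * q' s) * dx).
Proof.
intros Hp Hq Hp' Hq' Hx.
auto_derive; [repeat split; eexists; eassumption|].
replace (Derive (fun u => p u) s) with dp by (symmetry; now apply is_derive_unique).
replace (Derive (fun u => q u) s) with dq by (symmetry; now apply is_derive_unique).
replace (Derive (fun u => p' u) s) with dp' by (symmetry; now apply is_derive_unique).
replace (Derive (fun u => q' u) s) with dq' by (symmetry; now apply is_derive_unique).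
replace (Derive (fun u => x u) s) with dx by (symmetry; now apply is_derive_unique).
ring.
Qed.

(** With F, G the s-derivatives of f, g at s = 0, the derivative of the integrand is
    xi (f G' + F g' - g F' - G f'). Subtracting the t-derivative of xi (f G - g F), whose
    integral vanishes by periodicity, removes F' and G' and leaves twice the pairing of
    (F, G) with the half-density Lie derivative (1/2) xi' z + xi z'. *)
Lemma area_density_variation (f g : R -> R -> R) (xi : R -> R) :
  smooth2 f -> smooth2 g -> smooth xi ->
  (forall t, xi t * (f 0 t * partial1 g 0 t - g 0 t * partial1 f 0 t) =
             xi (t + 2) * (f 0 (t + 2) * partial1 g 0 (t + 2) - g 0 (t + 2) * partial1 f 0 (t + 2))) ->
  is_derive (fun s => RInt (fun t => area_density (f s) (g s) t * xi t) 0 2) 0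
    (2 * RInt (fun t =>
       partial1 f 0 t * (/ 2 * Derive xi t * g 0 t + xi t * Derive (g 0) t) -
       partial1 g 0 t * (/ 2 * Derive xi t * f 0 t + xi t * Derive (f 0) t)) 0 2).
Proof.
intros Hf Hg Hx Hper.
destruct (smooth2_unfold f Hf) as [_ [Ef [_ [F1 F2]]]].
destruct (smooth2_unfold g Hg) as [_ [Eg [_ [G1 G2]]]].
set (h := fun s t => (partial2 g s t * f s t + (-1) * (partial2 f s t * g s t)) * xi t).
assert (Hh : smooth2 h).
{ apply smooth2_mult; [apply smooth2_plus|now apply smooth2_second].
  - now apply smooth2_mult.
  - apply smooth2_mult; [apply smooth2_first, smooth_const|now apply smooth2_mult]. }
assert (D := is_derive_RInt_smooth2 h 0 2 0 Hh).
assert (F0 := smooth2_slice2 f 0 Hf); assert (G0 := smooth2_slice2 g 0 Hg).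
assert (F0' := smooth2_slice2 _ 0 F1); assert (G0' := smooth2_slice2 _ 0 G1).
set (Y := fun t =>
       partial1 f 0 t * (/ 2 * Derive xi t * g 0 t + xi t * Derive (g 0) t) -
       partial1 g 0 t * (/ 2 * Derive xi t * f 0 t + xi t * Derive (f 0) t)).
assert (HX : smooth (Derive xi)) by now apply smooth_Derive.
assert (HDf : smooth (Derive (f 0))) by now apply smooth_Derive.
assert (HDg : smooth (Derive (g 0))) by now apply smooth_Derive.
assert (HY : smooth Y) by (unfold Y; smooth_tac).
set (B := fun t => (f 0 t * partial1 g 0 t + -1 * (g 0 t * partial1 f 0 t)) * xi t).
assert (HB : smooth B) by (unfold B; smooth_tac).
assert (E : RInt (partial1 h 0) 0 2 = 2 * RInt Y 0 2).
{ assert (EB : RInt (Derive B) 0 2 = 0).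
  { rewrite RInt_Derive.
    - assert (H := Hper 0); rewrite Rplus_0_l in H; unfold B; lra.
    - intros x _; now apply smooth_ex_derive.
    - intros x _; now apply smooth_continuous, smooth_Derive. }
  transitivity (RInt (fun t => plus (Derive B t) (scal 2 (Y t))) 0 2).
  - apply RInt_ext; intros t _.
    assert (DB : Derive B t =
      (Derive (f 0) t * partial1 g 0 t + f 0 t * Derive (partial1 g 0) t
       - (Derive (g 0) t * partial1 f 0 t + g 0 t * Derive (partial1 f 0) t)) * xi t
      + (f 0 t * partial1 g 0 t - g 0 t * partial1 f 0 t) * Derive xi t).
    { apply is_derive_unique, is_derive_det; now apply smooth_correct. }
    assert (DH : partial1 h 0 t =
      (Derive (partial1 g 0) t * f 0 t + partial2 g 0 t * partial1 f 0 t
       - (Derive (partial1 f 0) t * g 0 t + partial2 f 0 t * partial1 g 0 t)) * xi t).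
    { assert (SF := partial_commute f 0 t Hf); assert (SG := partial_commute g 0 t Hg).
      assert (HF := Derive_correct _ _ (proj1 (proj2 (smooth2_unfold _ F2)) 0 t)).
      assert (HG := Derive_correct _ _ (proj1 (proj2 (smooth2_unfold _ G2)) 0 t)).
      change (is_derive (fun u => partial2 f u t) 0 (partial1 (partial2 f) 0 t)) in HF.
      change (is_derive (fun u => partial2 g u t) 0 (partial1 (partial2 g) 0 t)) in HG.
      rewrite SF in HF; rewrite SG in HG.
      assert (H := is_derive_unique _ _ _ (is_derive_det _ _ _ _ _ 0 _ _ _ _ _
        HG (Derive_correct _ _ (Ef 0 t)) HF (Derive_correct _ _ (Eg 0 t))
        (is_derive_const (V := R_NormedModule) (xi t) 0))).
      eapply eq_trans; [exact H|]; unfold zero, partial1, partial2; simpl; ring. }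
    rewrite DB, DH; unfold Y, partial2, plus, scal; simpl; unfold mult; simpl; field.
  - rewrite (RInt_plus (V := R_CompleteNormedModule)).
    + rewrite (RInt_scal (V := R_CompleteNormedModule)) by now apply smooth_ex_RInt.
      change (RInt (Derive B) 0 2 + 2 * RInt Y 0 2 = 2 * RInt Y 0 2); rewrite EB; ring.
    + now apply smooth_ex_RInt, smooth_Derive.
    + apply (smooth_ex_RInt (fun t => 2 * Y t)); smooth_tac. }
rewrite E in D.
apply (is_derive_ext (fun u => RInt (h u) 0 2)); [|exact D].
intros s; apply RInt_ext; intros t _.
change (h s t = area_density (f s) (g s) t * xi t); unfold h, area_density, partial2; ring.
Qed.

(** * Vector calculus in R^3 *)

Ltac vec_ring :=
  repeat match goal with v : vec |- _ => destruct v as [[? ?] ?] end;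
  unfold vdot, vcross, vadd, vscal, vx, vy, vz; simpl; ring.

Lemma vec_eq (u v : vec) : vx u = vx v -> vy u = vy v -> vz u = vz v -> u = v.
Proof. destruct u as [[? ?] ?], v as [[? ?] ?]; unfold vx, vy, vz; simpl; congruence. Qed.

Definition is_vderive (g : R -> vec) (t : R) (v : vec) : Prop :=
  is_derive (fun u => vx (g u)) t (vx v) /\
  is_derive (fun u => vy (g u)) t (vy v) /\
  is_derive (fun u => vz (g u)) t (vz v).

Lemma is_vderive_unique g t v : is_vderive g t v -> vDerive g t = v.
Proof.
intros [H1 [H2 H3]]; apply vec_eq; unfold vDerive, vx, vy, vz at 1; simpl;
  now apply is_derive_unique.
Qed.

Lemma vDerive_correct g t : smoothv g -> is_vderive g t (vDerive g t).
Proof. intros [H1 [H2 H3]]; refine (conj _ (conj _ _)); now apply smooth_correct. Qed.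

Lemma vDerive_ext (f g : R -> vec) t : (forall u, f u = g u) -> vDerive f t = vDerive g t.
Proof. intros H; now rewrite (functional_extensionality f g H). Qed.

Lemma smoothv_vDerive g : smoothv g -> smoothv (vDerive g).
Proof.
intros [H1 [H2 H3]]; repeat split; unfold vDerive, vx, vy, vz; simpl;
  now apply smooth_Derive.
Qed.

Lemma smooth_vdot f g : smoothv f -> smoothv g -> smooth (fun t => vdot (f t) (g t)).
Proof. intros [F1 [F2 F3]] [G1 [G2 G3]]; unfold vdot; smooth_tac. Qed.

Lemma smoothv_vcross f g : smoothv f -> smoothv g -> smoothv (fun t => vcross (f t) (g t)).
Proof.
intros [F1 [F2 F3]] [G1 [G2 G3]]; repeat split; unfold vcross, vx, vy, vz in *; simpl;
  smooth_tac.
Qed.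

Lemma smoothv_vscal a g : smooth a -> smoothv g -> smoothv (fun t => vscal (a t) (g t)).
Proof.
intros Ha [G1 [G2 G3]]; repeat split; unfold vscal, vx, vy, vz in *; simpl; smooth_tac.
Qed.

Lemma vDerive_lin f g a b t : smoothv f -> smoothv g ->
  vDerive (fun u => vadd (vscal a (f u)) (vscal b (g u))) t =
  vadd (vscal a (vDerive f t)) (vscal b (vDerive g t)).
Proof.
intros Hf Hg; apply is_vderive_unique.
destruct (vDerive_correct f t Hf) as [F1 [F2 F3]].
destruct (vDerive_correct g t Hg) as [G1 [G2 G3]].
assert (L : forall p q p' q', is_derive p t p' -> is_derive q t q' ->
  is_derive (fun u => a * p u + b * q u) t (a * p' + b * q'))
  by (intros p q p' q' Hp Hq; apply (is_derive_plus (fun u => a * p u) (fun u => b * q u));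
      now apply is_derive_scal).
refine (conj _ (conj _ _)).
- exact (L _ _ _ _ F1 G1).
- exact (L _ _ _ _ F2 G2).
- exact (L _ _ _ _ F3 G3).
Qed.

Lemma vDerive_const c t : vDerive (fun _ => c) t = (0, 0, 0).
Proof. unfold vDerive; now rewrite !Derive_const. Qed.

Lemma smoothv_const c : smoothv (fun _ => c).
Proof. repeat split; apply smooth_const. Qed.

Lemma vDerive_cross f g t : smoothv f -> smoothv g ->
  vDerive (fun u => vcross (f u) (g u)) t =
  vadd (vcross (vDerive f t) (g t)) (vcross (f t) (vDerive g t)).
Proof.
intros Hf Hg; apply is_vderive_unique.
destruct (vDerive_correct f t Hf) as [F1 [F2 F3]].
destruct (vDerive_correct g t Hg) as [G1 [G2 G3]].
assert (M : forall (p q r s : R -> R) dp dq dr ds l, is_derive p t dp -> is_derive q t dq ->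
  is_derive r t dr -> is_derive s t ds ->
  l = (dp * q t + p t * dq) - (dr * s t + r t * ds) ->
  is_derive (fun u => p u * q u - r u * s u) t l)
  by (intros p q r s dp dq dr ds l Hp Hq Hr Hs ->;
      apply (is_derive_minus (fun u => p u * q u) (fun u => r u * s u));
      now apply is_derive_product).
set (f' := vDerive f t) in *; set (g' := vDerive g t) in *; clearbody f' g'.
refine (conj _ (conj _ _)).
- apply (M _ _ _ _ _ _ _ _ _ F2 G3 F3 G2); destruct (f t), (g t); vec_ring.
- apply (M _ _ _ _ _ _ _ _ _ F3 G1 F1 G3); destruct (f t), (g t); vec_ring.
- apply (M _ _ _ _ _ _ _ _ _ F1 G2 F2 G1); destruct (f t), (g t); vec_ring.
Qed.

Lemma is_derive_quadratic (p q r s : R -> R) (x y t : R) :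
  smooth p -> smooth q -> smooth r -> smooth s ->
  is_derive (fun u => p u * q u + x * (r u * s u)) t
    (Derive p t * q t + p t * Derive q t + x * (Derive r t * s t + r t * Derive s t)).
Proof.
intros Hp Hq Hr Hs.
apply (is_derive_plus (fun u => p u * q u) (fun u => x * (r u * s u))).
- apply is_derive_product; now apply smooth_correct.
- apply is_derive_scal, is_derive_product; now apply smooth_correct.
Qed.

Lemma vDerive_vscal a g t : smooth a -> smoothv g ->
  vDerive (fun u => vscal (a u) (g u)) t =
  vadd (vscal (Derive a t) (g t)) (vscal (a t) (vDerive g t)).
Proof.
intros Ha Hg; apply is_vderive_unique.
destruct (vDerive_correct g t Hg) as [G1 [G2 G3]].
refine (conj _ (conj _ _)); apply is_derive_product; try assumption; now apply smooth_correct.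
Qed.

Lemma Derive_vdot f g t : smoothv f -> smoothv g ->
  Derive (fun u => vdot (f u) (g u)) t = vdot (vDerive f t) (g t) + vdot (f t) (vDerive g t).
Proof.
intros Hf Hg; apply is_derive_unique.
destruct (vDerive_correct f t Hf) as [F1 [F2 F3]].
destruct (vDerive_correct g t Hg) as [G1 [G2 G3]].
replace (vdot (vDerive f t) (g t) + vdot (f t) (vDerive g t)) with
 ((vx (vDerive f t) * vx (g t) + vx (f t) * vx (vDerive g t)) +
  (vy (vDerive f t) * vy (g t) + vy (f t) * vy (vDerive g t)) +
  (vz (vDerive f t) * vz (g t) + vz (f t) * vz (vDerive g t)))
 by (unfold vdot; ring).
unfold vdot.
apply (is_derive_plus (fun u => vx (f u) * vx (g u) + vy (f u) * vy (g u))
         (fun u => vz (f u) * vz (g u))); [|now apply is_derive_product].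
apply (is_derive_plus (fun u => vx (f u) * vx (g u)) (fun u => vy (f u) * vy (g u)));
  now apply is_derive_product.
Qed.

Lemma vdot_pos v : v <> (0, 0, 0) -> 0 < vdot v v.
Proof.
destruct v as [[x y] z]; intros H; unfold vdot, vx, vy, vz; simpl.
destruct (Req_dec x 0) as [->|]; [|nra].
destruct (Req_dec y 0) as [->|]; [|nra].
destruct (Req_dec z 0) as [->|]; [now elim H|nra].
Qed.

(** * Twist of a framed loop *)

(** V' . (T x V) is the rate of rotation of V about the unit tangent T; the factor |gamma'|
    gives weight one under scaling of the curve, like the length. *)
Definition twist (F : FramedLoop) (t : R) : R :=
  - vdot (vDerive (frame F) t) (vcross (vDerive (curve F) t) (frame F t)).

Definition speed (F : FramedLoop) (t : R) : R := vnorm (vDerive (curve F) t).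

Definition total_length (F : FramedLoop) : R := RInt (speed F) 0 2.

Lemma speed_smooth F : smooth (speed F).
Proof.
apply smooth_sqrt.
- intros t; apply vdot_pos, curve_immersion.
- apply smooth_vdot; apply smoothv_vDerive, curve_smooth.
Qed.

Lemma speed_pos F t : 0 < speed F t.
Proof. apply sqrt_lt_R0, vdot_pos, curve_immersion. Qed.

Lemma twist_translate F G c :
  (forall t, curve G t = vadd (curve F t) c) -> (forall t, frame G t = frame F t) ->
  (forall t, twist G t = twist F t) /\ (forall t, speed G t = speed F t).
Proof.
intros HC HV.
assert (E : forall t, vDerive (curve G) t = vDerive (curve F) t).
{ intros t; rewrite (vDerive_ext _ (fun u => vadd (vscal 1 (curve F u)) (vscal 1 c))).
  - rewrite (vDerive_lin (curve F) (fun _ => c)), vDerive_const;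
      [|apply curve_smooth|apply smoothv_const].
    apply vec_eq; unfold vadd, vscal, vx, vy, vz; simpl; ring.
  - intros u; rewrite HC; apply vec_eq; unfold vadd, vscal, vx, vy, vz; simpl; ring. }
split; intros t; unfold twist, speed; rewrite E; [|reflexivity].
now rewrite (vDerive_ext _ _ _ HV), HV.
Qed.

Lemma twist_scale F G a : 0 < a ->
  (forall t, curve G t = vscal a (curve F t)) -> (forall t, frame G t = frame F t) ->
  (forall t, twist G t = a * twist F t) /\ (forall t, speed G t = a * speed F t).
Proof.
intros Ha HC HV.
assert (E : forall t, vDerive (curve G) t = vscal a (vDerive (curve F) t)).
{ intros t; rewrite (vDerive_ext _ _ _ HC).
  unfold vDerive, vscal, vx, vy, vz; simpl; now rewrite !Derive_scal. }
split; intros t; unfold twist, speed; rewrite E.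
- rewrite (vDerive_ext _ _ _ HV), HV.
  unfold vdot, vcross, vscal, vx, vy, vz; simpl; ring.
- unfold vnorm; set (v := vDerive (curve F) t).
  transitivity (sqrt (a * a) * sqrt (vdot v v)); [|now rewrite sqrt_square by lra].
  rewrite <- sqrt_mult_alt by nra; f_equal.
  unfold vdot, vscal, vx, vy, vz; simpl; ring.
Qed.

Lemma vDerive_rotation A g t : rotation A -> smoothv g ->
  vDerive (fun u => A (g u)) t = A (vDerive g t).
Proof.
intros [e1 [e2 [_ [_ [_ HA]]]]] [G1 [G2 G3]].
rewrite (vDerive_ext _ _ _ (fun u => HA (g u))), HA; apply is_vderive_unique.
assert (L : forall a b c, is_derive (fun u => vx (g u) * a + (vy (g u) * b + vz (g u) * c)) t
   (vx (vDerive g t) * a + (vy (vDerive g t) * b + vz (vDerive g t) * c))).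
{ assert (S : forall h x, smooth h -> is_derive (fun u => h u * x) t (Derive h t * x))
    by (intros h x Hh; exact (is_derive_scal_l (V := R_NormedModule) h t _ x (smooth_correct h t Hh))).
  intros a b c.
  apply (is_derive_plus (fun u => vx (g u) * a) (fun u => vy (g u) * b + vz (g u) * c)).
  - now apply (S (fun u => vx (g u))).
  - apply (is_derive_plus (fun u => vy (g u) * b) (fun u => vz (g u) * c)).
    + now apply (S (fun u => vy (g u))).
    + now apply (S (fun u => vz (g u))). }
refine (conj _ (conj _ _)); apply L.
Qed.

Lemma rotation_vdot A u v : rotation A -> vdot (A u) (A v) = vdot u v.
Proof.
intros [e1 [e2 [H1 [H2 [H3 HA]]]]]; rewrite !HA.
transitivity (vx u * vx v * vdot e1 e1 + vy u * vy v * vdot e2 e2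
  + (vx u * vy v + vy u * vx v) * vdot e1 e2
  + vz u * vz v * (vdot e1 e1 * vdot e2 e2 - vdot e1 e2 * vdot e1 e2)); [clear; vec_ring|].
rewrite H1, H2, H3; unfold vdot; ring.
Qed.

(** The columns e1, e2, e1 x e2 of A have determinant |e1|^2 |e2|^2 - (e1 . e2)^2 = 1. *)
Lemma rotation_triple A u v w : rotation A ->
  vdot (A u) (vcross (A v) (A w)) = vdot u (vcross v w).
Proof.
intros [e1 [e2 [H1 [H2 [H3 HA]]]]]; rewrite !HA.
transitivity ((vdot e1 e1 * vdot e2 e2 - vdot e1 e2 * vdot e1 e2) * vdot u (vcross v w));
  [clear; vec_ring|].
rewrite H1, H2, H3; ring.
Qed.

Lemma twist_rotate F G A : rotation A ->
  (forall t, curve G t = A (curve F t)) -> (forall t, frame G t = A (frame F t)) ->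
  (forall t, twist G t = twist F t) /\ (forall t, speed G t = speed F t).
Proof.
intros HA HC HV.
assert (E : forall t, vDerive (curve G) t = A (vDerive (curve F) t))
  by (intros t; rewrite (vDerive_ext _ _ _ HC); apply vDerive_rotation, curve_smooth; exact HA).
split; intros t; unfold twist, speed, vnorm; rewrite E.
- rewrite (vDerive_ext _ _ _ HV), HV, vDerive_rotation, rotation_triple;
    try assumption; [reflexivity|apply frame_smooth].
- now rewrite rotation_vdot.
Qed.

(** With N = T x V, the left side expands by the Binet-Cauchy identities. The terms that the
    dot products in the hypotheses do not determine are V' . N, with coefficient c^2 + s^2, and
    multiples of T . V = 0. *)
Lemma spin_identity (T V T' V' : vec) (c s : R) : c * c + s * s = 1 ->
  vdot T T = 1 -> vdot V V = 1 -> vdot T V = 0 ->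
  vdot T' T = 0 -> vdot V' V = 0 ->
  vdot (vadd (vscal c V') (vscal s (vadd (vcross T' V) (vcross T V'))))
       (vcross T (vadd (vscal c V) (vscal s (vcross T V))))
  = vdot V' (vcross T V).
Proof.
intros Hcs TT VV TV TT' VV'.
transitivity ((c * c + s * s * vdot T T) * vdot V' (vcross T V)
  + c * s * ((vdot V' T * vdot T V - vdot V' V * vdot T T)
             + (vdot T' T * vdot V V - vdot T' V * vdot T V)
             + (vdot T T * vdot V' V - vdot T V * vdot V' T))
  + s * s * vdot T V * vdot (vcross T' V) T); [clear; vec_ring|].
rewrite TT, VV, TV, TT', VV'.
transitivity ((c * c + s * s) * vdot V' (vcross T V)); [ring|rewrite Hcs; ring].
Qed.

(** A constant rotation of the frame in its normal plane does not change its rate of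
    rotation. *)
Lemma twist_spin F G th :
  (forall t, curve G t = curve F t) ->
  (forall t, frame G t =
     vadd (vscal (cos th) (frame F t))
          (vscal (sin th) (vcross (tangent F t) (frame F t)))) ->
  (forall t, twist G t = twist F t) /\ (forall t, speed G t = speed F t).
Proof.
intros HC HV.
assert (E : forall t, vDerive (curve G) t = vDerive (curve F) t)
  by (intros t; now apply vDerive_ext).
split; intros t; unfold twist, speed; rewrite E; [|reflexivity].
assert (HT : smoothv (tangent F)).
{ apply (smoothv_vscal (fun t => / speed F t)).
  - apply smooth_inv, speed_smooth; intros u; apply Rgt_not_eq, speed_pos.
  - apply smoothv_vDerive, curve_smooth. }
assert (HF := frame_smooth F).
assert (ET : forall u, vDerive (curve F) u = vscal (speed F u) (tangent F u)).
{ intros u; assert (N := speed_pos F u); unfold tangent; fold (speed F u).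
  apply vec_eq; unfold vscal, vx, vy, vz; simpl; field; lra. }
assert (TT : forall u, vdot (tangent F u) (tangent F u) = 1).
{ intros u; assert (N := speed_pos F u).
  assert (S : speed F u * speed F u = vdot (vDerive (curve F) u) (vDerive (curve F) u))
    by (apply sqrt_sqrt; left; apply vdot_pos, curve_immersion).
  transitivity (/ speed F u * / speed F u * vdot (vDerive (curve F) u) (vDerive (curve F) u)).
  - unfold tangent; fold (speed F u); unfold vdot, vscal, vx, vy, vz; simpl; ring.
  - rewrite <- S; field; lra. }
assert (TV : forall u, vdot (tangent F u) (frame F u) = 0).
{ intros u; transitivity (/ speed F u * vdot (frame F u) (vDerive (curve F) u)).
  - unfold tangent; fold (speed F u); unfold vdot, vscal, vx, vy, vz; simpl; ring.
  - rewrite frame_normal; ring. }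
assert (Z : forall g, smoothv g -> (forall u, vdot (g u) (g u) = 1) ->
  vdot (vDerive g t) (g t) = 0).
{ intros g Hg H1; assert (D := Derive_vdot g g t Hg Hg).
  rewrite (Derive_ext _ (fun _ => 1) _ H1), Derive_const in D.
  replace (vdot (g t) (vDerive g t)) with (vdot (vDerive g t) (g t)) in D
    by (unfold vdot; ring); lra. }
rewrite (vDerive_ext _ _ _ HV), HV.
rewrite (vDerive_lin (frame F) (fun u => vcross (tangent F u) (frame F u)))
  by (try assumption; now apply smoothv_vcross).
rewrite vDerive_cross, ET by assumption.
assert (S : forall u v w, vdot u (vcross (vscal (speed F t) v) w)
              = speed F t * vdot u (vcross v w)) by (intros; vec_ring).
rewrite !S; do 2 f_equal; apply spin_identity; auto using frame_unit.
rewrite Rplus_comm; apply sin2_cos2.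
Qed.

(** * The momentum map *)

(** Dividing by the length gives a function invariant under all moves. For the framed loop of
    a Stiefel pair the twist is twice the momentum and the length is 2, so no further factor
    is needed. *)
Definition normalized_twist (F : FramedLoop) (t : R) : R := twist F t * / total_length F.

Lemma normalized_twist_move F G t : framed_move F G ->
  normalized_twist G t = normalized_twist F t.
Proof.
assert (K : forall a, 0 < a -> (forall u, twist G u = a * twist F u) /\
  (forall u, speed G u = a * speed F u) -> normalized_twist G t = normalized_twist F t).
{ intros a Ha [HT HS]; unfold normalized_twist, total_length; rewrite HT.
  rewrite (RInt_ext (speed G) (fun u => scal a (speed F u))) by (intros u _; apply HS).
  rewrite (RInt_scal (V := R_CompleteNormedModule)) by apply smooth_ex_RInt, speed_smooth.
  unfold scal; simpl; unfold mult; simpl.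
  rewrite Rinv_mult.
  transitivity (a * / a * (twist F t * / RInt (speed F) 0 2)); [ring|].
  rewrite Rinv_r by lra; ring. }
assert (K1 : (forall u, twist G u = twist F u) /\ (forall u, speed G u = speed F u) ->
  normalized_twist G t = normalized_twist F t)
  by (intros [HT HS]; apply (K 1 Rlt_0_1); split; intros u; rewrite Rmult_1_l; auto).
intros [c H1 H2|A HA H1 H2|a Ha H1 H2|th H1 H2].
- apply K1; exact (twist_translate F G c H1 H2).
- apply K1; exact (twist_rotate F G A HA H1 H2).
- apply (K a Ha); exact (twist_scale F G a Ha H1 H2).
- apply K1; exact (twist_spin F G th H1 H2).
Qed.

Lemma normalized_twist_equiv F G t : framed_equiv F G ->
  normalized_twist F t = normalized_twist G t.
Proof.
induction 1 as [F G H|F|F G _ IH|F G H _ IH1 _ IH2]; try congruence.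
symmetry; now apply normalized_twist_move.
Qed.

Lemma vDerive_period g t : smoothv g -> (forall u, g (u + 2) = g u) ->
  vDerive g (t + 2) = vDerive g t.
Proof.
intros [G1 [G2 G3]] Hp.
assert (H : forall f, smooth f -> (forall u, f (u + 2) = f u) -> Derive f (t + 2) = Derive f t).
{ intros f Hf Hq; rewrite (Derive_quasiperiodic f 1); [ring|exact Hf|].
  intros u; rewrite Hq; ring. }
unfold vDerive; rewrite !H; try assumption; try reflexivity; intros u; now rewrite Hp.
Qed.

Lemma normalized_twist_smooth F : smooth (normalized_twist F).
Proof.
apply smooth_mult; [|apply smooth_const]; apply smooth_opp, smooth_vdot.
- apply smoothv_vDerive, frame_smooth.
- apply smoothv_vcross; [apply smoothv_vDerive, curve_smooth|apply frame_smooth].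
Qed.

Lemma normalized_twist_period F t : normalized_twist F (t + 2) = normalized_twist F t.
Proof.
unfold normalized_twist, twist; rewrite frame_period, !vDerive_period;
  auto using frame_smooth, frame_period, curve_smooth, curve_period.
Qed.

Definition twist_loop (F : FramedLoop) : LoopR :=
  mkLoopR (normalized_twist F) (normalized_twist_smooth F) (normalized_twist_period F).

(** A representative is chosen; [momentum_class] shows that the choice does not matter. *)
Definition momentum (m : Moduli) : LoopR :=
  twist_loop (proj1_sig (constructive_indefinite_description _ (proj2_sig m))).

Lemma momentum_class F t : momentum (framed_class F) t = normalized_twist F t.
Proof.
unfold momentum; destruct (constructive_indefinite_description _ _) as [G HG]; simpl in *.
symmetry; apply normalized_twist_equiv; rewrite HG; apply rst_refl.
Qed.

Definition momentum_density (P : R -> C * C) (t : R) : R :=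
  Im (CDerive (fun u => fst (P u)) t * Cconj (fst (P t))
      + CDerive (fun u => snd (P u)) t * Cconj (snd (P t)))%C.

(** * The momentum map on Stiefel pairs *)

Section Hopf.

Variables (k : kind) (P : St k).

Let a t := Re (fst (P t)).
Let b t := Im (fst (P t)).
Let c t := Re (snd (P t)).
Let d t := Im (snd (P t)).

Let Ha : smooth a. Proof. apply (st_inV2 k P). Qed.
Let Hb : smooth b. Proof. apply (st_inV2 k P). Qed.
Let Hc : smooth c. Proof. apply (st_inV2 k P). Qed.
Let Hd : smooth d. Proof. apply (st_inV2 k P). Qed.

(** |gamma'| = |q|^2, and the two components of q have norm 1. *)
Lemma total_length_hopf : total_length (framed_loop_of k P) = 2.
Proof.
assert (N1 := f_equal Re (st_norm1 k P)); assert (N2 := f_equal Re (st_norm2 k P)).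
rewrite L2E in N1, N2 by now split.
unfold Re at 1 in N1; unfold Re at 1 in N2; simpl in N1, N2.
transitivity (RInt (fun t => plus (a t * a t + b t * b t) (c t * c t + d t * d t)) 0 2).
- apply RInt_ext; intros t _; unfold speed, vnorm; simpl.
  rewrite hopf_curve_derive, hopf_velocity_norm2.
  rewrite sqrt_pow2 by (left; apply qnorm2_gt0, st_nonzero).
  rewrite qnorm2E; unfold plus, a, b, c, d; simpl; ring.
- rewrite (RInt_plus (V := R_CompleteNormedModule)) by (apply smooth_ex_RInt; smooth_tac).
  change (RInt (fun t => a t * a t + b t * b t) 0 2
          + RInt (fun t => c t * c t + d t * d t) 0 2 = 2).
  unfold a, b, c, d; rewrite N1, N2; unfold Re; simpl; ring.
Qed.

(** The imaginary part of conj(q) j q, that is |q|^2 V, written as sums p q + x r s for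
    [is_derive_quadratic]. *)
Definition unnormalized_frame (t : R) : vec :=
  (2 * (a t * d t + 1 * (b t * c t)),
   a t * a t + (-1) * (b t * b t) + (c t * c t + (-1) * (d t * d t)),
   2 * (c t * d t + (-1) * (a t * b t))).

Lemma unnormalized_frameE t :
  unnormalized_frame t = vscal (qnorm2 (P t)) (frame (framed_loop_of k P) t).
Proof.
assert (N := qnorm2_gt0 _ (st_nonzero k P t)).
simpl; rewrite hopf_frameE; apply vec_eq;
  unfold unnormalized_frame, vscal, vx, vy, vz, a, b, c, d; simpl; field; lra.
Qed.

Lemma unnormalized_frame_derive t :
  vDerive unnormalized_frame t =
  (2 * (Derive a t * d t + a t * Derive d t + 1 * (Derive b t * c t + b t * Derive c t)),
   (Derive a t * a t + a t * Derive a t + (-1) * (Derive b t * b t + b t * Derive b t)) +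
   (Derive c t * c t + c t * Derive c t + (-1) * (Derive d t * d t + d t * Derive d t)),
   2 * (Derive c t * d t + c t * Derive d t + (-1) * (Derive a t * b t + a t * Derive b t))).
Proof.
apply is_vderive_unique; refine (conj _ (conj _ _)).
- apply is_derive_scal, is_derive_quadratic; assumption.
- apply (is_derive_plus (fun u => a u * a u + (-1) * (b u * b u))
          (fun u => c u * c u + (-1) * (d u * d u))); now apply is_derive_quadratic.
- apply is_derive_scal, is_derive_quadratic; assumption.
Qed.

(** V' . (gamma' x V) is quadratic in V, and V itself is orthogonal to gamma' x V, so V may
    be replaced by h = |q|^2 V at the price of a factor |q|^4. After this h' . (gamma' x h)
    is a polynomial in q and q', and the claim is a polynomial identity. *)
Lemma twist_hopf t : twist (framed_loop_of k P) t = 2 * momentum_density P t.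
Proof.
assert (N := qnorm2_gt0 _ (st_nonzero k P t)).
set (F := framed_loop_of k P).
assert (E : vDerive unnormalized_frame t =
  vadd (vscal (Derive (fun u => qnorm2 (P u)) t) (frame F t))
       (vscal (qnorm2 (P t)) (vDerive (frame F) t))).
{ rewrite (vDerive_ext _ _ _ unnormalized_frameE); apply vDerive_vscal.
  - apply st_qnorm2_smooth.
  - apply frame_smooth. }
assert (ED : vDerive (curve F) t = hopf_velocity (P t)) by apply hopf_curve_derive.
assert (H : qnorm2 (P t) * qnorm2 (P t) * twist F t =
  - vdot (vDerive unnormalized_frame t) (vcross (hopf_velocity (P t)) (unnormalized_frame t))).
{ rewrite E, unnormalized_frameE; fold F; unfold twist; rewrite ED.
  generalize (frame F t) (vDerive (frame F) t) (hopf_velocity (P t))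
    (Derive (fun u => qnorm2 (P u)) t) (qnorm2 (P t)).
  clear; intros; vec_ring. }
apply (Rmult_eq_reg_l (qnorm2 (P t) * qnorm2 (P t))); [|nra].
rewrite H, unnormalized_frame_derive, hopf_velocityE, qnorm2E.
unfold momentum_density, CDerive.
change (fun u => Re (fst (P u))) with a; change (fun u => Im (fst (P u))) with b.
change (fun u => Re (snd (P u))) with c; change (fun u => Im (snd (P u))) with d.
fold (a t) (b t) (c t) (d t).
unfold unnormalized_frame, vdot, vcross, vx, vy, vz, Cplus, Cmult, Cconj; simpl.
change (fst (fst (P t))) with (a t); change (snd (fst (P t))) with (b t).
change (fst (snd (P t))) with (c t); change (snd (snd (P t))) with (d t).
ring.
Qed.

Lemma momentum_cls t : momentum (cls P) t = momentum_density P t.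
Proof.
unfold cls; rewrite momentum_class; unfold normalized_twist.
rewrite total_length_hopf, twist_hopf; field.
Qed.

End Hopf.

(** * Sesquilinearity of the L^2 product *)

Lemma smoothC_plus f g : smoothC f -> smoothC g -> smoothC (fun t => (f t + g t)%C).
Proof.
intros [F1 F2] [G1 G2]; unfold smoothC, Re, Im in *; simpl; split; smooth_tac.
Qed.

Lemma smoothC_mult f g : smoothC f -> smoothC g -> smoothC (fun t => (f t * g t)%C).
Proof.
intros [F1 F2] [G1 G2]; unfold smoothC, Re, Im in *; simpl; split; smooth_tac.
Qed.

Lemma smoothC_const c : smoothC (fun _ => c).
Proof. split; apply smooth_const. Qed.

Lemma smoothC_scal c f : smoothC f -> smoothC (fun t => (c * f t)%C).
Proof. intros Hf; apply smoothC_mult; [apply smoothC_const|exact Hf]. Qed.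

Lemma inV_plus k f g : inV k f -> inV k g -> inV k (fun t => (f t + g t)%C).
Proof.
intros [F1 F2] [G1 G2]; split; [now apply smoothC_plus|].
intros t; rewrite F2, G2; ring.
Qed.

Lemma inV_scal k c f : inV k f -> inV k (fun t => (c * f t)%C).
Proof.
intros [F1 F2]; split; [now apply smoothC_scal|].
intros t; rewrite F2; ring.
Qed.

Lemma inV_mult_loop k (x : LoopR) f : inV k f -> inV k (fun t => (RtoC (x t) * f t)%C).
Proof.
intros [F1 F2]; split.
- apply (smoothC_mult (fun t => RtoC (x t))); [|exact F1].
  split; [apply loop_smooth|apply (smooth_const 0)].
- intros t; rewrite F2, loop_period; ring.
Qed.

Lemma inV_CDerive k f : inV k f -> inV k (CDerive f).
Proof.
intros [[F1 F2] Fp]; split.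
- split; unfold Re, Im, CDerive; simpl; now apply smooth_Derive.
- intros t; unfold CDerive.
  rewrite (Derive_quasiperiodic (fun u => Re (f u)) (Defs.sign k)),
    (Derive_quasiperiodic (fun u => Im (f u)) (Defs.sign k)); try assumption.
  + unfold Cmult, RtoC; simpl; f_equal; ring.
  + intros u; rewrite Fp; unfold Im; simpl; ring.
  + intros u; rewrite Fp; unfold Re; simpl; ring.
Qed.

Lemma RInt_lin f g h x y : smooth f -> smooth g -> smooth h ->
  RInt (fun t => f t + (x * g t + y * h t)) 0 2 =
  RInt f 0 2 + (x * RInt g 0 2 + y * RInt h 0 2).
Proof.
intros Hf Hg Hh.
assert (Ig := smooth_ex_RInt g 0 2 Hg); assert (Ih := smooth_ex_RInt h 0 2 Hh).
assert (If := smooth_ex_RInt f 0 2 Hf).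
assert (Sg := ex_RInt_scal g 0 2 x Ig); assert (Sh := ex_RInt_scal h 0 2 y Ih).
etransitivity; [exact (RInt_plus f _ 0 2 If (ex_RInt_plus _ _ 0 2 Sg Sh))|].
apply (f_equal (fun z => RInt f 0 2 + z)).
etransitivity; [exact (RInt_plus _ _ 0 2 Sg Sh)|].
exact (f_equal2 Rplus (RInt_scal g 0 2 x Ig) (RInt_scal h 0 2 y Ih)).
Qed.

Lemma L2_ext f g f' g' : (forall t, f t = f' t) -> (forall t, g t = g' t) ->
  L2 f g = L2 f' g'.
Proof.
intros Hf Hg; now rewrite (functional_extensionality _ _ Hf), (functional_extensionality _ _ Hg).
Qed.

Lemma L2_conj f g : smoothC f -> smoothC g -> L2 g f = Cconj (L2 f g).
Proof.
intros Hf Hg; rewrite !L2E by assumption.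
destruct Hf as [F1 F2], Hg as [G1 G2].
unfold Cconj; cbn [fst snd]; f_equal.
- apply RInt_ext; intros t _; simpl; real_ring.
- rewrite <- (RInt_opp (V := R_CompleteNormedModule)) by (apply smooth_ex_RInt; smooth_tac).
  apply RInt_ext; intros t _; unfold opp; simpl; real_ring.
Qed.

(** The integral is taken in a real normed module, so a complex scalar passes through it by
    way of real and imaginary parts. *)
Lemma L2_lin_l c f g h : smoothC f -> smoothC g -> smoothC h ->
  L2 (fun t => (f t + c * g t)%C) h = (L2 f h + c * L2 g h)%C.
Proof.
intros Hf Hg Hh.
rewrite (L2E _ _ (smoothC_plus _ _ Hf (smoothC_scal c _ Hg)) Hh), !L2E by assumption.
destruct Hf as [F1 F2], Hg as [G1 G2], Hh as [H1 H2].
unfold Cplus, Cmult; cbn [fst snd]; f_equal.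
- transitivity (RInt (fun t => (Re (f t) * Re (h t) + Im (f t) * Im (h t))
    + (fst c * (Re (g t) * Re (h t) + Im (g t) * Im (h t))
       + (- snd c) * (Im (g t) * Re (h t) - Re (g t) * Im (h t)))) 0 2).
  + apply RInt_ext; intros t _; unfold Re, Im; simpl; real_ring.
  + rewrite (RInt_lin (fun t => Re (f t) * Re (h t) + Im (f t) * Im (h t))
     (fun t => Re (g t) * Re (h t) + Im (g t) * Im (h t))
     (fun t => Im (g t) * Re (h t) - Re (g t) * Im (h t))) by smooth_tac; real_ring.
- transitivity (RInt (fun t => (Im (f t) * Re (h t) - Re (f t) * Im (h t))
    + (fst c * (Im (g t) * Re (h t) - Re (g t) * Im (h t))
       + snd c * (Re (g t) * Re (h t) + Im (g t) * Im (h t)))) 0 2).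
  + apply RInt_ext; intros t _; unfold Re, Im; simpl; real_ring.
  + rewrite (RInt_lin (fun t => Im (f t) * Re (h t) - Re (f t) * Im (h t))
     (fun t => Im (g t) * Re (h t) - Re (g t) * Im (h t))
     (fun t => Re (g t) * Re (h t) + Im (g t) * Im (h t))) by smooth_tac; real_ring.
Qed.

Lemma L2_lin_r c f g h : smoothC f -> smoothC g -> smoothC h ->
  L2 h (fun t => (f t + c * g t)%C) = (L2 h f + Cconj c * L2 h g)%C.
Proof.
intros Hf Hg Hh.
rewrite (L2_conj (fun t => (f t + c * g t)%C) h) by (try assumption; now apply smoothC_plus, smoothC_scal).
rewrite L2_lin_l, (L2_conj f h), (L2_conj g h) by assumption.
now rewrite Cplus_conj, Cmult_conj.
Qed.

Lemma L2_scal_l c f g : smoothC f -> smoothC g ->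
  L2 (fun t => (c * f t)%C) g = (c * L2 f g)%C.
Proof.
intros Hf Hg.
rewrite (L2_ext _ g (fun t => (f t + (c - 1) * f t)%C) g)
  by (intros; (reflexivity || ring)).
rewrite L2_lin_l by assumption; ring.
Qed.

Lemma L2_scal_r c f g : smoothC f -> smoothC g ->
  L2 g (fun t => (c * f t)%C) = (Cconj c * L2 g f)%C.
Proof.
intros Hf Hg; rewrite (L2_conj (fun t => (c * f t)%C) g) by (try assumption; now apply smoothC_scal).
now rewrite L2_scal_l, Cmult_conj, <- L2_conj by assumption.
Qed.

(** * Horizontal projection *)

Section Projection.

Variables (k : kind) (P : St k).

Let phi t := fst (P t).
Let psi t := snd (P t).

Let phiV : inV k phi. Proof. apply (st_inV2 k P). Qed.
Let psiV : inV k psi. Proof. apply (st_inV2 k P). Qed.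

Let phi_phi : L2 phi phi = RtoC 1. Proof. apply (st_norm1 k P). Qed.
Let psi_psi : L2 psi psi = RtoC 1. Proof. apply (st_norm2 k P). Qed.
Let phi_psi : L2 phi psi = RtoC 0. Proof. apply (st_orth k P). Qed.
Let psi_phi : L2 psi phi = RtoC 0.
Proof.
rewrite (L2_conj phi psi), phi_psi by (apply phiV || apply psiV).
unfold Cconj, RtoC; simpl; f_equal; ring.
Qed.

(** The component of y orthogonal to phi and psi. Horizontality constrains each component of
    a tangent vector separately, so the projection acts componentwise. *)
Definition reject (y : R -> C) (t : R) : C :=
  (y t + - L2 y phi * phi t + - L2 y psi * psi t)%C.

Lemma reject_inV y : inV k y -> inV k (reject y).
Proof. intros Hy; unfold reject; apply inV_plus; [apply inV_plus|]; auto using inV_scal. Qed.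

Lemma reject_orthogonal y : inV k y ->
  L2 phi (reject y) = RtoC 0 /\ L2 psi (reject y) = RtoC 0.
Proof.
intros Hy.
assert (Y := proj1 Hy); assert (F := proj1 phiV); assert (S := proj1 psiV).
assert (YF : smoothC (fun t => (y t + - L2 y phi * phi t)%C))
  by (apply smoothC_plus; auto using smoothC_scal).
unfold reject; split; rewrite !L2_lin_r by assumption;
  rewrite !Copp_conj, <- (L2_conj y phi), <- (L2_conj y psi) by assumption;
  rewrite ?phi_phi, ?phi_psi, ?psi_phi, ?psi_psi; ring.
Qed.

(** What is subtracted is a combination of phi and psi in each component, and horizontal
    vectors have both components orthogonal to phi and psi. *)
Lemma is_proj_reject Y : inV2 k Y ->
  is_proj P Y (fun t => (reject (fun u => fst (Y u)) t, reject (fun u => snd (Y u)) t)).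
Proof.
intros [H1 H2].
destruct (reject_orthogonal _ H1) as [O1 O2], (reject_orthogonal _ H2) as [O3 O4].
split; [exact (conj (conj (reject_inV _ H1) (reject_inV _ H2)) (conj O1 (conj O4 (conj O3 O2))))|].
intros W [[W1 W2] [P1 [P2 [P3 P4]]]].
assert (F := proj1 phiV); assert (S := proj1 psiV).
assert (Z : forall y w, smoothC w -> L2 phi w = RtoC 0 -> L2 psi w = RtoC 0 ->
  L2 (fun t => (y t - reject y t)%C) w = RtoC 0).
{ intros y w Hw HF HS.
  rewrite (L2_ext _ w (fun t => (L2 y phi * phi t + L2 y psi * psi t)%C) w)
    by (intros; (reflexivity || (unfold reject; ring))).
  rewrite L2_lin_l, L2_scal_l, HF, HS by (try assumption; now apply smoothC_scal); ring. }
unfold L2pair, path_sub; cbn [fst snd].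
rewrite (Z _ _ (proj1 W1) P1 P4), (Z _ _ (proj1 W2) P3 P2); ring.
Qed.

End Projection.

Lemma generator_inV2 (xi : LoopR) k (P : St k) : inV2 k (generator xi P).
Proof.
assert (D : forall t, Derive xi (t + 2) = Derive xi t).
{ intros t; rewrite (Derive_quasiperiodic xi 1); [ring|apply loop_smooth|].
  intros u; rewrite loop_period; ring. }
set (dxi := mkLoopR (fun t => / 2 * Derive xi t)
  (smooth_mult _ _ (smooth_const _) (smooth_Derive _ (loop_smooth xi)))
  (fun t => f_equal (Rmult (/ 2)) (D t))).
destruct (st_inV2 k P) as [H1 H2].
split; apply inV_plus.
- exact (inV_mult_loop k dxi _ H1).
- exact (inV_mult_loop k xi _ (inV_CDerive k _ H1)).
- exact (inV_mult_loop k dxi _ H2).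
- exact (inV_mult_loop k xi _ (inV_CDerive k _ H2)).
Qed.

(** * Smooth curves of Stiefel pairs with a given horizontal velocity *)

Lemma Derive_even_0 f : smooth f -> (forall s, f (- s) = f s) -> Derive f 0 = 0.
Proof.
intros Hf He.
assert (H : Derive (fun s => f (- s)) 0 = Derive f 0) by now apply Derive_ext.
rewrite (Derive_comp f Ropp) in H.
- rewrite Ropp_0, (Derive_opp (fun s => s)), Derive_id in H; lra.
- now apply smooth_ex_derive.
- auto_derive; exact I.
Qed.

Section Pencil.

Variables (E F sg : R -> R) (f d f' d' : R -> C).
Hypotheses (HE : smooth E) (HF : smooth F) (Hsg : smooth sg).
Hypotheses (Hf : smoothC f) (Hd : smoothC d) (Hf' : smoothC f') (Hd' : smoothC d').

(** A family in which the parameter and the loop variable separate: smooth coefficients of s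
    times fixed loops. Both components of the orthonormalized line P + sg(s) D have this
    shape, with E, F even in s and sg odd. *)
Definition pencil (s t : R) : C :=
  (RtoC (E s) * (f t + RtoC (sg s) * d t) + RtoC (F s) * (f' t + RtoC (sg s) * d' t))%C.

Lemma pencil_smooth2 :
  smooth2 (fun s t => Re (pencil s t)) /\ smooth2 (fun s t => Im (pencil s t)).
Proof.
assert (K : forall p q p' q' : R -> R, smooth p -> smooth q -> smooth p' -> smooth q' ->
  smooth2 (fun s t => E s * (p t + sg s * q t) + F s * (p' t + sg s * q' t))).
{ intros; apply smooth2_plus; apply smooth2_mult; try now apply smooth2_first.
  - apply smooth2_plus; [now apply smooth2_second|].
    apply smooth2_mult; [now apply smooth2_first|now apply smooth2_second].
  - apply smooth2_plus; [now apply smooth2_second|].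
    apply smooth2_mult; [now apply smooth2_first|now apply smooth2_second]. }
split.
- replace (fun s t => Re (pencil s t)) with
    (fun s t => E s * (Re (f t) + sg s * Re (d t)) + F s * (Re (f' t) + sg s * Re (d' t))).
  + apply K; [apply Hf|apply Hd|apply Hf'|apply Hd'].
  + apply fun_ext2; intros s t; unfold pencil, Re; simpl; ring.
- replace (fun s t => Im (pencil s t)) with
    (fun s t => E s * (Im (f t) + sg s * Im (d t)) + F s * (Im (f' t) + sg s * Im (d' t))).
  + apply K; [apply Hf|apply Hd|apply Hf'|apply Hd'].
  + apply fun_ext2; intros s t; unfold pencil, Im; simpl; ring.
Qed.

Hypotheses (E_even : forall s, E (- s) = E s) (F_even : forall s, F (- s) = F s).
Hypotheses (sg0 : sg 0 = 0) (dsg0 : Derive sg 0 = 1).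

(** Even coefficients have zero derivative at 0, so only the derivative of sg contributes. *)
Lemma pencil_velocity t :
  CDerive (fun s => pencil s t) 0 = (RtoC (E 0%R) * d t + RtoC (F 0%R) * d' t)%C.
Proof.
assert (L : forall G x y, smooth G -> (forall s, G (- s) = G s) ->
  is_derive (fun s => G s * (x + sg s * y)) 0 (G 0 * y)).
{ intros G x y HG HGe.
  assert (D1 := smooth_correct G 0 HG); rewrite Derive_even_0 in D1 by assumption.
  assert (D2 := smooth_correct sg 0 Hsg); rewrite dsg0 in D2.
  assert (D3 := is_derive_product _ _ _ _ _ D2 (is_derive_const (V := R_NormedModule) y 0)).
  assert (D4 := is_derive_plus _ _ _ _ _ (is_derive_const (V := R_NormedModule) x 0) D3).
  assert (D5 := is_derive_product _ _ _ _ _ D1 D4).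
  unfold plus, zero in D5; simpl in D5; rewrite sg0 in D5.
  replace (G 0 * y) with (0 * (x + 0 * y) + G 0 * (0 + (1 * y + 0 * 0))) by ring.
  exact D5. }
assert (K : forall x y x' y',
  Derive (fun s => E s * (x + sg s * y) + F s * (x' + sg s * y')) 0 = E 0 * y + F 0 * y').
{ intros x y x' y'; apply is_derive_unique.
  apply (is_derive_plus (fun s => E s * (x + sg s * y)) (fun s => F s * (x' + sg s * y')));
    now apply L. }
unfold CDerive, pencil.
rewrite (Derive_ext (fun s => Re _)
  (fun s => E s * (Re (f t) + sg s * Re (d t)) + F s * (Re (f' t) + sg s * Re (d' t))))
  by (intros s; unfold Re; simpl; ring).
rewrite (Derive_ext (fun s => Im _)
  (fun s => E s * (Im (f t) + sg s * Im (d t)) + F s * (Im (f' t) + sg s * Im (d' t))))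
  by (intros s; unfold Im; simpl; ring).
rewrite !K; unfold Cplus, Cmult, RtoC, Re, Im; simpl; f_equal; ring.
Qed.

End Pencil.

(** The coefficients are given by the equations they satisfy, so that the explicit square
    roots only have to be examined where the curve is built. *)
Lemma gram_schmidt k (q1 q2 : R -> C) (a b A B : R) (h l : C) :
  inV k q1 -> inV k q2 ->
  L2 q1 q1 = RtoC a -> L2 q2 q2 = RtoC b -> L2 q2 q1 = h ->
  (h + l * RtoC a = 0)%C ->
  (RtoC A * RtoC A * RtoC a = 1)%C ->
  (RtoC B * RtoC B * (RtoC b + l * Cconj h) = 1)%C ->
  let c1 := fun t => (RtoC A * q1 t)%C in
  let c2 := fun t => (RtoC B * (q2 t + l * q1 t))%C in
  inV k c1 /\ inV k c2 /\
  L2 c1 c1 = RtoC 1 /\ L2 c2 c2 = RtoC 1 /\ L2 c1 c2 = RtoC 0.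
Proof.
intros V1 V2 H11 H22 H21 Hl HA HB c1 c2.
assert (S1 := proj1 V1); assert (S2 := proj1 V2).
assert (V2' : inV k (fun t => (q2 t + l * q1 t)%C)) by (apply inV_plus; auto using inV_scal).
assert (S2' := proj1 V2').
assert (H12 : L2 q1 q2 = Cconj h) by now rewrite (L2_conj q2 q1), H21.
assert (RC : forall x, Cconj (RtoC x) = RtoC x)
  by (intros x; unfold Cconj, RtoC; simpl; f_equal; ring).
assert (Hl' : (Cconj h + Cconj l * RtoC a = 0)%C).
{ rewrite <- (RC a), <- Cmult_conj, <- Cplus_conj, Hl; unfold Cconj, RtoC; simpl; f_equal; ring. }
split; [now apply inV_scal|split; [now apply inV_scal|]].
unfold c1, c2; split; [|split].
- rewrite L2_scal_l, L2_scal_r, H11, RC by (try assumption; now apply smoothC_scal).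
  rewrite <- HA; ring.
- rewrite L2_scal_l, L2_scal_r, RC by (try assumption; now apply smoothC_scal).
  rewrite L2_lin_l, !L2_lin_r, H11, H12, H21, H22 by assumption.
  transitivity (RtoC B * RtoC B * (RtoC b + l * Cconj h) +
     RtoC B * RtoC B * (Cconj l * (h + l * RtoC a)))%C; [ring|].
  rewrite HB, Hl; ring.
- rewrite L2_scal_l, L2_scal_r, RC by (try assumption; now apply smoothC_scal).
  rewrite L2_lin_r, H11, H12, Hl' by assumption; ring.
Qed.

(** [extension_unique] with sign 1 moves any t into the compact period. *)
Lemma periodic_bounded f : smooth f -> (forall t, f (t + 2) = f t) ->
  exists M, forall t, f t <= M.
Proof.
intros Hf Hp.
destruct (continuity_ab_maj f 0 2) as [m [Hm _]]; [lra| |].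
- intros t _; now apply continuity_pt_filterlim, smooth_continuous.
- exists (f m); intros t.
  rewrite (extension_unique 1 ltac:(ring) f t) by (intros u; rewrite Hp; ring).
  assert (H := cell_bounds t); unfold extension.
  replace (powerRZ 1 (cell t)) with 1.
  + rewrite Rmult_1_l; apply Hm; lra.
  + destruct (cell t); simpl; rewrite ?pow1; field.
Qed.

Lemma qnorm2_smooth (Q : R -> C * C) :
  smoothC (fun t => fst (Q t)) -> smoothC (fun t => snd (Q t)) -> smooth (fun t => qnorm2 (Q t)).
Proof.
intros [H1 H2] [H3 H4].
apply (smooth_ext (fun t => Re (fst (Q t)) * Re (fst (Q t)) + Im (fst (Q t)) * Im (fst (Q t))
  + (Re (snd (Q t)) * Re (snd (Q t)) + Im (snd (Q t)) * Im (snd (Q t))))); [|smooth_tac].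
intros t; rewrite qnorm2E; ring.
Qed.

Lemma qnorm2_scal x y z : qnorm2 (RtoC x * y, RtoC x * z)%C = x * x * qnorm2 (y, z).
Proof. rewrite !qnorm2E; unfold Re, Im; simpl; ring. Qed.

Lemma qnorm2_ratio_bounded k (P : St k) D : inV2 k D ->
  exists M, 0 <= M /\ forall t, qnorm2 (D t) <= M * qnorm2 (P t).
Proof.
intros [[D1 D1p] [D2 D2p]].
assert (N := fun t => qnorm2_gt0 _ (st_nonzero k P t)).
destruct (periodic_bounded (fun t => qnorm2 (D t) * / qnorm2 (P t))) as [M HM].
- apply smooth_mult; [now apply qnorm2_smooth|].
  apply smooth_inv, st_qnorm2_smooth; intros t; apply Rgt_not_eq, N.
- intros t; rewrite st_period, qnorm2_scal.
  rewrite (surjective_pairing (D (t + 2))), D1p, D2p, qnorm2_scal, <- !surjective_pairing.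
  assert (Nt := N t); destruct k; simpl; field; lra.
- exists (Rmax M 0); split; [apply Rmax_r|intros t].
  assert (Nt := N t); assert (Ht := HM t); assert (X := Rmax_l M 0).
  apply Rle_trans with (M * qnorm2 (P t)); [|nra].
  apply (Rmult_le_compat_r (qnorm2 (P t))) in Ht; [|lra].
  rewrite Rmult_assoc, Rinv_l, Rmult_1_r in Ht by lra; exact Ht.
Qed.

(** sg s = s / (1 + K s^2). A bound for all s is needed because a curve of Stiefel pairs is
    indexed by the whole line. *)
Lemma bounded_parameter K : 1 <= K -> exists sg : R -> R,
  smooth sg /\ (forall s, sg (- s) = - sg s) /\ sg 0 = 0 /\ Derive sg 0 = 1 /\
  forall s, K * (sg s * sg s) < 1.
Proof.
intros HK.
assert (Hp : forall s, 0 < 1 + K * (s * s)) by (intros s; nra).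
assert (HI : smooth (fun s => / (1 + K * (s * s)))).
{ apply smooth_inv; [intros s; apply Rgt_not_eq, Hp|].
  assert (S := smooth_id); smooth_tac. }
exists (fun s => s * / (1 + K * (s * s))); refine (conj _ (conj _ (conj _ (conj _ _)))).
- apply smooth_mult; [apply smooth_id|exact HI].
- intros s; replace (- s * - s) with (s * s) by ring; ring.
- ring.
- assert (H := is_derive_unique _ _ _ (is_derive_product (fun s => s) _ 0 _ _
    (is_derive_id 0) (smooth_correct _ 0 HI))).
  etransitivity; [exact H|]; unfold one; simpl; field.
- intros s; assert (P := Hp s).
  replace (K * (s * / (1 + K * (s * s)) * (s * / (1 + K * (s * s)))))
    with (K * (s * s) * / ((1 + K * (s * s)) * (1 + K * (s * s)))) by (field; lra).
  apply (Rmult_lt_reg_r ((1 + K * (s * s)) * (1 + K * (s * s)))); [nra|].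
  rewrite Rmult_assoc, Rinv_l by nra.
  assert (0 <= K * (s * s)) by nra; nra.
Qed.

Lemma L2_self f : smoothC f -> exists a, 0 <= a /\ L2 f f = RtoC a.
Proof.
intros Hf; exists (RInt (fun t => Re (f t) * Re (f t) + Im (f t) * Im (f t)) 0 2).
rewrite (L2E f f) by assumption; destruct Hf as [F1 F2]; split.
- apply RInt_ge_0; [lra|apply smooth_ex_RInt; smooth_tac|intros; nra].
- unfold RtoC; f_equal.
  rewrite (RInt_ext _ (fun _ => 0)) by (intros t _; simpl; ring).
  rewrite RInt_const; unfold scal; simpl; unfold mult; simpl; ring.
Qed.

Lemma Cmult_real_eq0 (x : R) (z : C) : x <> 0 -> (RtoC x * z)%C = RtoC 0 -> z = RtoC 0.
Proof.
intros Hx H; destruct (Ceq_dec z 0) as [|Hz]; [assumption|].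
exfalso; apply (Cmult_neq_0 (RtoC x) z); try assumption.
intros E; apply Hx; exact (f_equal fst E).
Qed.

(** The curve is the Gram-Schmidt orthonormalization of P + sg(s) D. Since D is horizontal,
    the Gram matrix of P + sg(s) D is the identity plus sg(s)^2 times that of D: it is even
    in s, so orthonormalizing does not change the velocity at 0. The bound on sg keeps
    P + sg(s) D free of zeros and makes the Gram determinant positive. *)
Lemma curve_exists k (P : St k) D : horizontal P D -> exists c, curve_through c P D.
Proof.
intros [[D1 D2] [O1 [O2 [O3 O4]]]].
destruct (st_inV2 k P) as [P1 P2].
set (phi := fun t => fst (P t)) in *; set (psi := fun t => snd (P t)) in *.
set (dphi := fun t => fst (D t)) in *; set (dpsi := fun t => snd (D t)) in *.
assert (N1 : L2 phi phi = RtoC 1) by apply (st_norm1 k P).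
assert (N2 : L2 psi psi = RtoC 1) by apply (st_norm2 k P).
assert (N3 : L2 phi psi = RtoC 0) by apply (st_orth k P).
assert (SP1 := proj1 P1); assert (SP2 := proj1 P2).
assert (SD1 := proj1 D1); assert (SD2 := proj1 D2).
assert (C0 : Cconj (RtoC 0) = RtoC 0) by (unfold Cconj, RtoC; simpl; f_equal; ring).
assert (CR : forall x, Cconj (RtoC x) = RtoC x)
  by (intros x; unfold Cconj, RtoC; simpl; f_equal; ring).
assert (O1' : L2 dphi phi = RtoC 0) by now rewrite (L2_conj phi dphi), O1.
assert (O2' : L2 dpsi psi = RtoC 0) by now rewrite (L2_conj psi dpsi), O2.
assert (O3' : L2 dpsi phi = RtoC 0) by now rewrite (L2_conj phi dpsi), O3.
assert (N3' : L2 psi phi = RtoC 0) by now rewrite (L2_conj phi psi), N3.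
destruct (L2_self dphi SD1) as [al [al0 Hal]].
destruct (L2_self dpsi SD2) as [be [be0 Hbe]].
set (g := L2 dpsi dphi).
set (G := Re g * Re g + Im g * Im g).
assert (G0 : 0 <= G) by (unfold G; nra).
assert (HG : (g * Cconj g)%C = RtoC G)
  by (unfold G, Cmult, Cconj, RtoC, Re, Im; simpl; f_equal; ring).
destruct (qnorm2_ratio_bounded k P D (conj D1 D2)) as [M [M0 HM]].
(* K = 1 + M + G gives sg^2 M < 1, hence no zeros, and sg^4 G < 1, hence a positive Gram
   determinant. *)
destruct (bounded_parameter (1 + M + G)) as [sg [Ssg [sg_odd [sg0 [dsg0 Hsg]]]]]; [lra|].
set (u := fun s => sg s * sg s).
assert (u_even : forall s, u (- s) = u s) by (intros s; unfold u; rewrite sg_odd; ring).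
assert (u0 : forall s, 0 <= u s) by (intros s; unfold u; nra).
assert (Su : smooth u) by (unfold u; smooth_tac).
set (n1 := fun s => 1 + u s * al).
assert (n1_pos : forall s, 0 < n1 s) by (intros s; assert (H := u0 s); unfold n1; nra).
(* q2 + la g q1 is orthogonal to q1, and n1, n2 are the squared norms of q1 and of this
   combination. *)
set (la := fun s => - u s * / n1 s).
set (n2 := fun s => 1 + u s * be + la s * (u s * G)).
assert (n2_pos : forall s, 0 < n2 s).
{ intros s; assert (H := u0 s); assert (Hs := Hsg s); fold (u s) in Hs.
  assert (Hn := n1_pos s).
  assert (Hn1 : 1 <= n1 s) by (unfold n1; nra).
  assert (Hi : 0 < / n1 s <= 1).
  { split; [now apply Rinv_0_lt_compat|].
    rewrite <- Rinv_1; apply Rinv_le_contravar; lra. }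
  assert (X : u s * (u s * G) < 1) by nra.
  assert (X0 : 0 <= u s * (u s * G)) by (apply Rmult_le_pos; [lra|nra]).
  unfold n2, la.
  assert (/ n1 s * (u s * (u s * G)) < 1) by nra.
  nra. }
assert (Sn1 : smooth n1) by (unfold n1; smooth_tac).
assert (Sla : smooth la).
{ apply smooth_mult; [now apply smooth_opp|].
  apply smooth_inv; [intros s; apply Rgt_not_eq, n1_pos|exact Sn1]. }
assert (Sn2 : smooth n2) by (unfold n2; smooth_tac).
assert (HA : forall n, smooth n -> (forall s, 0 < n s) -> smooth (fun s => / sqrt (n s))).
{ intros n Sn Hn; apply smooth_inv; [|now apply smooth_sqrt].
  intros s; apply Rgt_not_eq, sqrt_lt_R0, Hn. }
assert (HA2 : forall n, 0 < n -> / sqrt n * / sqrt n * n = 1).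
{ intros n Hn; assert (S := sqrt_lt_R0 _ Hn).
  rewrite <- (sqrt_sqrt n) at 3 by lra; field; lra. }
set (A := fun s => / sqrt (n1 s)); set (B := fun s => / sqrt (n2 s)).
assert (SA : smooth A) by now apply HA.
assert (SB : smooth B) by now apply HA.
set (c1 := pencil A (fun _ => 0) sg phi dphi phi dphi).
set (c2 := pencil B (fun s => B s * la s) sg psi dpsi
             (fun t => (g * phi t)%C) (fun t => (g * dphi t)%C)).
set (q1 := fun s t => (phi t + RtoC (sg s) * dphi t)%C).
set (q2 := fun s t => (psi t + RtoC (sg s) * dpsi t)%C).
assert (E1 : forall s t, c1 s t = (RtoC (A s) * q1 s t)%C)
  by (intros s t; unfold c1, q1, pencil; ring).
assert (E2 : forall s t, c2 s t = (RtoC (B s) * (q2 s t + RtoC (la s) * g * q1 s t))%C)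
  by (intros s t; unfold c2, q1, q2, pencil; rewrite RtoC_mult; ring).
assert (HSt : forall s, {Q : St k | forall t, Q t = (c1 s t, c2 s t)}).
{ intros s.
  assert (V1 : inV k (q1 s)) by (apply inV_plus; [|apply inV_scal]; assumption).
  assert (V2 : inV k (q2 s)) by (apply inV_plus; [|apply inV_scal]; assumption).
  assert (S1 := proj1 V1); assert (S2 := proj1 V2).
  destruct (gram_schmidt k (q1 s) (q2 s) (n1 s) (1 + u s * be) (A s) (B s)
    (RtoC (u s) * g)%C (RtoC (la s) * g)%C) as [W1 [W2 [W3 [W4 W5]]]]; try assumption.
  - unfold q1; rewrite L2_lin_l, !L2_lin_r, N1, O1, O1', Hal, CR by assumption.
    unfold n1, u; rewrite !RtoC_plus, !RtoC_mult; ring.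
  - unfold q2; rewrite L2_lin_l, !L2_lin_r, N2, O2, O2', Hbe, CR by assumption.
    unfold u; rewrite !RtoC_plus, !RtoC_mult; ring.
  - unfold q1, q2; rewrite L2_lin_l, !L2_lin_r, N3', O3', O4, CR by assumption.
    fold g; unfold u; rewrite !RtoC_mult; ring.
  - transitivity (g * RtoC (u s + la s * n1 s))%C; [rewrite RtoC_plus, RtoC_mult; ring|].
    replace (u s + la s * n1 s) with 0; [ring|].
    unfold la; field; apply Rgt_not_eq, n1_pos.
  - rewrite <- !RtoC_mult; f_equal; apply HA2, n1_pos.
  - rewrite Cmult_conj, CR.
    transitivity (RtoC (B s) * RtoC (B s) *
      (RtoC (1 + u s * be) + RtoC (la s) * (RtoC (u s) * (g * Cconj g))))%C; [ring|].
    rewrite HG, <- !RtoC_mult, <- RtoC_plus, <- RtoC_mult; f_equal; apply HA2, n2_pos.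
  - rewrite <- (functional_extensionality _ _ (E1 s)) in W1, W3, W5.
    rewrite <- (functional_extensionality _ _ (E2 s)) in W2, W4, W5.
    assert (NZ : forall t, (c1 s t, c2 s t) <> (RtoC 0, RtoC 0)).
    { intros t H; assert (H1 := f_equal fst H); assert (H2 := f_equal snd H).
      cbn [fst snd] in H1, H2.
      assert (Z1 : q1 s t = RtoC 0).
      { apply (Cmult_real_eq0 (A s)); [|now rewrite <- E1].
        apply Rinv_neq_0_compat, Rgt_not_eq, sqrt_lt_R0, n1_pos. }
      assert (Z2 : q2 s t = RtoC 0).
      { apply (Cmult_real_eq0 (B s)).
        - apply Rinv_neq_0_compat, Rgt_not_eq, sqrt_lt_R0, n2_pos.
        - rewrite <- H2, E2, Z1; ring. }
      (* At a zero, P = - sg D, against |D|^2 <= M |P|^2 and sg^2 M < 1. *)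
      assert (EP : qnorm2 (P t) = u s * qnorm2 (D t)).
      { replace (P t) with (RtoC (- sg s) * dphi t, RtoC (- sg s) * dpsi t)%C.
        - rewrite qnorm2_scal; unfold dphi, dpsi; rewrite <- surjective_pairing.
          unfold u; ring.
        - rewrite (surjective_pairing (P t)); change (fst (P t)) with (phi t).
          change (snd (P t)) with (psi t).
          unfold q1 in Z1; unfold q2 in Z2; rewrite RtoC_opp; f_equal.
          + transitivity (RtoC 0 - RtoC (sg s) * dphi t)%C; [ring|rewrite <- Z1; ring].
          + transitivity (RtoC 0 - RtoC (sg s) * dpsi t)%C; [ring|rewrite <- Z2; ring]. }
      assert (NP := qnorm2_gt0 _ (st_nonzero k P t)); assert (HMt := HM t).
      assert (Hs := Hsg s); fold (u s) in Hs; assert (Us := u0 s).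
      assert (u s * qnorm2 (D t) <= u s * M * qnorm2 (P t)) by nra.
      assert (u s * M < 1) by nra.
      nra. }
    exists (mkSt k (fun t => (c1 s t, c2 s t)) (conj W1 W2) W3 W4 W5 NZ).
    reflexivity. }
assert (A_even : forall s, A (- s) = A s) by (intros s; unfold A, n1; now rewrite u_even).
assert (B_even : forall s, B (- s) = B s)
  by (intros s; unfold B, n2, la, n1; now rewrite u_even).
assert (L_even : forall s, B (- s) * la (- s) = B s * la s)
  by (intros s; rewrite B_even; unfold la, n1; now rewrite u_even).
assert (U0 : u 0 = 0) by (unfold u; rewrite sg0; ring).
assert (la0 : la 0 = 0) by (unfold la; rewrite U0; ring).
assert (A0 : A 0 = 1)
  by (unfold A, n1; rewrite U0, Rmult_0_l, Rplus_0_r, sqrt_1; apply Rinv_1).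
assert (B0 : B 0 = 1)
  by (unfold B, n2; rewrite la0, U0, !Rmult_0_l, !Rplus_0_r, sqrt_1; apply Rinv_1).
set (c := fun s => proj1_sig (HSt s)).
assert (Hc : forall s t, c s t = (c1 s t, c2 s t)) by (intros s; exact (proj2_sig (HSt s))).
exists c.
assert (T1 : (fun s t => fst (c s t)) = c1)
  by (apply fun_ext2; intros s t; now rewrite Hc).
assert (T2 : (fun s t => snd (c s t)) = c2)
  by (apply fun_ext2; intros s t; now rewrite Hc).
assert (SB' : smooth (fun s => B s * la s)) by smooth_tac.
split; [|split].
- destruct (pencil_smooth2 A (fun _ => 0) sg phi dphi phi dphi) as [R1 I1];
    auto using smooth_const.
  destruct (pencil_smooth2 B (fun s => B s * la s) sg psi dpsi
             (fun t => (g * phi t)%C) (fun t => (g * dphi t)%C)) as [R2 I2];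
    auto using smoothC_scal.
  fold c1 in R1, I1; fold c2 in R2, I2; rewrite <- T1 in R1, I1; rewrite <- T2 in R2, I2.
  exact (conj R1 (conj I1 (conj R2 I2))).
- intros t; rewrite Hc, E1, E2; unfold q1, q2; rewrite A0, B0, sg0, la0.
  rewrite (surjective_pairing (P t)); unfold phi, psi; f_equal; ring.
- intros t; rewrite (surjective_pairing (D t)); f_equal.
  + change (fst (D t) = CDerive (fun s => (fun s t => fst (c s t)) s t) 0); rewrite T1.
    unfold c1; rewrite pencil_velocity; auto using smooth_const.
    rewrite A0; unfold dphi; ring.
  + change (snd (D t) = CDerive (fun s => (fun s t => snd (c s t)) s t) 0); rewrite T2.
    unfold c2; rewrite pencil_velocity; auto.
    rewrite B0, la0, Rmult_0_r; unfold dpsi; ring.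
Qed.

(** * The Hamiltonian identity *)

(** The difference Y - X is orthogonal to every horizontal vector, in particular to D. *)
Lemma omega_proj k (P : St k) D Y X : inV2 k Y -> horizontal P D -> is_proj P Y X ->
  omega D X = omega D Y.
Proof.
intros [Y1 Y2] HD [[[X1 X2] _] HX].
assert (H := HX D HD); destruct HD as [[D1 D2] _].
assert (L : forall x y d, smoothC x -> smoothC y -> smoothC d ->
  L2 (fun t => (y t - x t)%C) d = (L2 y d - L2 x d)%C).
{ intros x y d Hx Hy Hd.
  rewrite (L2_ext _ d (fun t => (y t + - RtoC 1 * x t)%C) d) by (intros; (reflexivity || ring)).
  rewrite L2_lin_l by assumption; ring. }
destruct D1 as [D1 _], D2 as [D2 _], Y1 as [Y1 _], Y2 as [Y2 _], X1 as [X1 _], X2 as [X2 _].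
unfold omega, L2pair, path_sub in *; cbn [fst snd] in H.
rewrite !L in H by assumption.
rewrite (L2_conj (fun t => fst (X t))), (L2_conj (fun t => snd (X t))),
  (L2_conj (fun t => fst (Y t))), (L2_conj (fun t => snd (Y t))) by assumption.
assert (HI := f_equal Im H); unfold Im, Cminus, Cplus, Copp, Cconj in *; simpl in *; lra.
Qed.

(** The boundary term of [area_density_variation] is periodic because the sign of the loop
    or antiloop enters it squared. *)
Lemma component_variation k (xi : LoopR) (f : R -> R -> C) (p dp : R -> C) :
  smooth2 (fun s t => Re (f s t)) -> smooth2 (fun s t => Im (f s t)) ->
  inV k p -> inV k dp ->
  (forall t, f 0 t = p t) -> (forall t, dp t = CDerive (fun s => f s t) 0) ->
  is_derive (fun s => RInt (fun t => area_density (fun u => Re (f s u)) (fun u => Im (f s u)) t * xi t) 0 2) 0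
    (2 * - Im (L2 dp (fun t => (RtoC (/ 2 * Derive xi t) * p t + RtoC (xi t) * CDerive p t)%C))).
Proof.
intros HR HI Hp Hdp H0 Hd.
assert (H0' : f 0 = p) by now apply functional_extensionality.
set (Y := fun t => (RtoC (/ 2 * Derive xi t) * p t + RtoC (xi t) * CDerive p t)%C).
assert (HY : smoothC Y).
{ assert (Sx := loop_smooth xi); assert (Sx' := smooth_Derive _ Sx).
  apply smoothC_plus; apply smoothC_mult; try apply Hp; try apply (inV_CDerive k p Hp);
    split; unfold Re, Im; simpl; smooth_tac. }
assert (E1 : forall t, partial1 (fun s t => Re (f s t)) 0 t = Re (dp t)) by (intros t; now rewrite Hd).
assert (E2 : forall t, partial1 (fun s t => Im (f s t)) 0 t = Im (dp t)) by (intros t; now rewrite Hd).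
assert (V := area_density_variation _ _ xi HR HI (loop_smooth xi)).
replace (2 * - Im (L2 dp Y)) with (2 * RInt (fun t =>
  partial1 (fun s t => Re (f s t)) 0 t * (/ 2 * Derive xi t * Im (f 0 t) + xi t * Derive (fun u => Im (f 0 u)) t) -
  partial1 (fun s t => Im (f s t)) 0 t * (/ 2 * Derive xi t * Re (f 0 t) + xi t * Derive (fun u => Re (f 0 u)) t)) 0 2).
- apply V; intros t; rewrite !E1, !E2, H0', loop_period, (proj2 Hp), (proj2 Hdp).
  destruct k; unfold Re, Im; simpl; ring.
- apply (f_equal (Rmult 2)); rewrite (L2E _ _ (proj1 Hdp) HY).
  destruct Hdp as [[Q1 Q2] _], HY as [Y1 Y2].
  assert (HI' : ex_RInt (fun t => Im (dp t) * Re (Y t) - Re (dp t) * Im (Y t)) 0 2)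
    by (apply smooth_ex_RInt; smooth_tac).
  etransitivity; [|exact (RInt_opp (V := R_CompleteNormedModule) _ 0 2 HI')].
  apply RInt_ext; intros t _; rewrite E1, E2, H0'; unfold Y, CDerive, opp, Re, Im; simpl; real_ring.
Qed.

Lemma momentum_densityE P t : momentum_density P t =
  area_density (fun u => Re (fst (P u))) (fun u => Im (fst (P u))) t +
  area_density (fun u => Re (snd (P u))) (fun u => Im (snd (P u))) t.
Proof. unfold momentum_density, area_density, CDerive, Re, Im; simpl; ring. Qed.

(** The two components contribute separately, and the symplectic pairing is with the
    generator before projection; [omega_proj] relates it to the induced field. *)
Lemma momentum_variation (xi : LoopR) k (P : St k) D (c : R -> St k) :
  inV2 k D -> curve_through c P D ->
  is_derive (fun s => pairing (momentum (cls (c s))) xi) 0 (omega D (generator xi P)).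
Proof.
intros [D1 D2] [[R1 [I1 [R2 I2]]] [H0 Hd]].
destruct (st_inV2 k P) as [P1 P2].
assert (V1 := component_variation k xi (fun s t => fst (c s t)) (fun t => fst (P t))
  (fun t => fst (D t)) R1 I1 P1 D1 (fun t => f_equal fst (H0 t)) (fun t => f_equal fst (Hd t))).
assert (V2 := component_variation k xi (fun s t => snd (c s t)) (fun t => snd (P t))
  (fun t => snd (D t)) R2 I2 P2 D2 (fun t => f_equal snd (H0 t)) (fun t => f_equal snd (Hd t))).
assert (V := is_derive_scal _ _ (/ 2) _ (is_derive_plus _ _ _ _ _ V1 V2)).
replace (omega D (generator xi P)) with
 (/ 2 * (2 * - Im (L2 (fun t => fst (D t)) (fun t => fst (generator xi P t))) +
         2 * - Im (L2 (fun t => snd (D t)) (fun t => snd (generator xi P t)))))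
 by (unfold omega, L2pair, Im; simpl; field).
eapply is_derive_ext; [|exact V].
intros s; unfold pairing; apply (f_equal (Rmult (/ 2))).
assert (S : forall f g, smooth f -> smooth g -> smooth (fun t => area_density f g t * xi t)).
{ intros f g Hf Hg; assert (Hx := loop_smooth xi); assert (F' := smooth_Derive _ Hf).
  assert (G' := smooth_Derive _ Hg); unfold area_density; smooth_tac. }
rewrite <- (RInt_plus (V := R_CompleteNormedModule)).
- apply RInt_ext; intros t _; rewrite momentum_cls, momentum_densityE.
  unfold plus; simpl; real_ring.
- apply smooth_ex_RInt, S; [exact (smooth2_slice2 _ s R1)|exact (smooth2_slice2 _ s I1)].
- apply smooth_ex_RInt, S; [exact (smooth2_slice2 _ s R2)|exact (smooth2_slice2 _ s I2)].
Qed.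

Theorem mainTheorem8 :
  exists mu : Moduli -> LoopR,
    (forall (k : kind) (P : St k) (t : R),
       mu (cls P) t =
       Im (CDerive (fun u => fst (P u)) t * Cconj (fst (P t))
           + CDerive (fun u => snd (P u)) t * Cconj (snd (P t)))%C) /\
    forall (xi : LoopR) (k : kind) (P : St k),
      exists X : R -> C * C,
        induced_field xi P X /\
        forall D : R -> C * C, horizontal P D ->
          is_differential (fun m => pairing (mu m) xi) P D (omega D X).
Proof.
exists momentum; split; [intros k P t; apply momentum_cls|].
intros xi k P.
assert (HY := generator_inV2 xi k P).
assert (HX := is_proj_reject k P _ HY).
eexists; split; [exact HX|].
intros D HD; split; [now apply curve_exists|].
intros c Hc; rewrite (omega_proj k P D _ _ HY HD HX).
apply momentum_variation; [apply HD|exact Hc].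
Qed.
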